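(* There exists a normal binary sequence $S$ such that (1) $R_{\mathrm{PPM}^*}(S)=0$, and (2) $\rho_{\mathrm{LZ}}(S)=1$. Here $R_T(S)=\limsup_{m\to\infty}|T(S\upharpoonright m)|/m$ and $\rho_T(S)=\liminf_{m\to\infty}|T(S\upharpoonright m)|/m$.
   Context: $S\upharpoonright m$ is the length-$m$ prefix of $S$; $\log$ is base $2$. A binary sequence $S$ is normal if for every $w\in\{0,1\}^*$, $\lim_{n\to\infty}\mathrm{occ}(w,S\upharpoonright n)/n=2^{-|w|}$, where $\mathrm{occ}(w,x)$ is the number of occurrences of $w$ as a substring of $x$. $\mathrm{LZ}$ is the Lempel-Ziv 78 compressor: it parses $x=x_1x_2\cdots x_n$ into phrases, each new phrase being the shortest prefix of the remaining input that is not an earlier phrase (the last phrase may repeat), so each $x_i=x_{l(i)}b_i$ with $l(i)<i$, $x_0=\lambda$, $b_i$ a bit; it outputs $c_{l(1)}b_1c_{l(2)}b_2\cdots c_{l(n)}b_n$ where $c_j$ is a prefix-free encoding of the pointer $j$. The $\mathrm{PPM}^*$ compressor (without exclusion, escape Method C) on binary input: after reading a prefix $x$, each stored context $c$ has, for each bit $b$, a frequency count equal to the number of occurrences of $cb$ in $x$, and an escape count equal to the number of distinct bits that have followed $c$ in $x$; deterministic means escape count $1$. The stored contexts are the empty context and, whenever a string $w$ occurs at least twice in $x$, the contexts $wb$ for each bit $b$ such that $wb$ occurs in $x$ followed by a further bit. Relevant contexts are stored contexts that are suffixes of $x$; the current context is the shortest deterministic relevant one, or the longest relevant one if none is deterministic.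 If the next bit $b$ has count $f>0$ in the current context it is encoded with probability $f/(T+e)$ ($T$ total bit count, $e$ escape count); otherwise an escape is encoded with probability $e/(T+e)$ and the next shorter relevant context becomes current; if $b$ is unseen even in the empty context, after the escape it is encoded with probability $1/2$. The model is then updated. The output is an arithmetic code of length $\lceil -\log P\rceil+O(1)$, $P$ the product of all probabilities used. *)

(* Defs.v *)
From Stdlib Require Import Reals.
From Coquelicot Require Import Coquelicot.
From mathcomp Require Import all_boot.

Set Implicit Arguments.
Unset Strict Implicit.
Unset Printing Implicit Defensive.
Open Scope nat_scope.

Definition binseq := nat -> bool.

Definition pref (S : binseq) (m : nat) : seq bool := mkseq S m.

Definition occ (w x : seq bool) : nat :=
  count (fun i => take (size w) (drop i x) == w) (iota 0 (size x - size w).+1).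

Fixpoint bin_aux (fuel n : nat) : seq bool :=
  match fuel with
  | 0 => [::]
  | f.+1 => if n is 0 then [::] else rcons (bin_aux f n./2) (odd n)
  end.
Definition bin (n : nat) : seq bool := bin_aux n n.

Definition elias_gamma (n : nat) : seq bool :=
  nseq (size (bin n)).-1 false ++ bin n.
Definition elias_delta (n : nat) : seq bool :=
  elias_gamma (size (bin n)) ++ behead (bin n).

Definition ptr_code (j : nat) : seq bool := elias_delta j.+1.

(** LZ78 parsing: [D] is the list of phrases so far (D`_0 = empty word),
    [r] the remaining input.  Each new phrase is the shortest prefix of [r]
    not in [D] (or all of [r] if every prefix is in [D]).  Returns the list
    of pairs (l(i), b_i). *)
Fixpoint lz_parse (fuel : nat) (D : seq (seq bool)) (r : seq bool)
  : seq (nat * bool) :=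
  match fuel with
  | 0 => [::]
  | f.+1 =>
    match r with
    | [::] => [::]
    | _ :: _ =>
      let j := find (fun k => take k.+1 r \notin D) (iota 0 (size r)) in
      let k := minn j.+1 (size r) in
      (index (take k.-1 r) D, nth false r k.-1)
        :: lz_parse f (rcons D (take k r)) (drop k r)
    end
  end.

Definition LZ (x : seq bool) : seq bool :=
  flatten [seq ptr_code p.1 ++ [:: p.2] | p <- lz_parse (size x) [:: [::]] x].

Definition lz_len (x : seq bool) : nat := size (LZ x).

(** * PPM* (no exclusion, escape method C), binary input *)

Definition cnt (c : seq bool) (b : bool) (x : seq bool) : nat := occ (rcons c b) x.
Definition tot (c x : seq bool) : nat := cnt c false x + cnt c true x.
Definition esc (c x : seq bool) : nat :=
  (0 < cnt c false x) + (0 < cnt c true x).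

Definition stored (c x : seq bool) : bool :=
  if c is [::] then true
  else (1 < occ (take (size c).-1 c) x) && (0 < tot c x).

Definition ctx_suffix (k : nat) (x : seq bool) : seq bool := drop (size x - k) x.

Definition relevant (x : seq bool) : seq nat :=
  [seq k <- iota 0 (size x).+1 | stored (ctx_suffix k x) x].

Definition deterministic (x : seq bool) (k : nat) : bool :=
  esc (ctx_suffix k x) x == 1.

Definition current (x : seq bool) : nat :=
  let rl := relevant x in
  if has (deterministic x) rl then nth 0 rl (find (deterministic x) rl)
  else last 0 rl.

Open Scope R_scope.

Definition normal (S : binseq) : Prop :=
  forall w : seq bool,
    is_lim_seq (fun n => (INR (occ w (pref S n)) / INR n)) (/ 2 ^ size w).

Definition log2 (r : R) : R := (ln r / ln 2).

Definition ratio (L : seq bool -> nat) (S : binseq) (m : nat) : R :=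
  (INR (L (pref S m)) / INR m).

Definition upper_rate (L : seq bool -> nat) (S : binseq) : Rbar :=
  LimSup_seq (ratio L S).
Definition lower_rate (L : seq bool -> nat) (S : binseq) : Rbar :=
  LimInf_seq (ratio L S).

(** probability assigned to bit b, walking down the chain [ks] of relevant
    context lengths (decreasing, ending with 0 = empty context) *)
Fixpoint ppm_chain (x : seq bool) (ks : seq nat) (b : bool) : R :=
  match ks with
  | [::] => (1 / 2)
  | k :: ks' =>
    let c := ctx_suffix k x in
    let f := cnt c b x in
    let T := tot c x in
    let e := esc c x in
    if (0 < f)%N then (INR f / INR (T + e)%N)
    else ((if (T == 0)%N then 1 else INR e / INR (T + e)%N) * ppm_chain x ks' b)
  end.

Definition ppm_prob_bit (x : seq bool) (b : bool) : R :=
  ppm_chain x (rev [seq k <- relevant x | (k <= current x)%N]) b.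

Definition ppm_prob (x : seq bool) : R :=
  foldr (fun i acc => ppm_prob_bit (take i x) (nth false x i) * acc) 1
        (iota 0%N (size x)).

(** L is the output-length function of an arithmetic coder for PPM*:
    |L x| = ceil(-log P(x)) + O(1) *)
Definition ppm_code_length (L : seq bool -> nat) : Prop :=
  exists C : R, forall x : seq bool,
    (Rabs (INR (L x) - - log2 (ppm_prob x)) <= C).

(* Main.v *)
(** The sequence lists all binary words in order of length.  The words of
    length n come from a cyclic de Bruijn sequence of order n, read n times:
    since the period 2^n and the step n have lcm(n,2^n) as least common multiple,
    shifting the cycle by one position after every lcm(n,2^n) bits makes the n-bit
    blocks of these n passes run through every word of length n exactly once.

    LZ78 then parses the sequence exactly into these blocks, and every block of
    length n points to a phrase of length n-1, which costs n-1+O(log n) bits.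
    Each pass contains each fixed word w about 2^(n-|w|) times, which gives
    normality.

    For PPM* on level n: all contexts shorter than n-2 have been followed by both
    bits, and longer ones have occurred only polynomially often, so that every
    bit costs O(log n).  From the second pass on, most contexts of length n+n^2
    have only been followed by the right bit: the occurrences followed by the
    wrong one are at least n^2 apart, because n consecutive bits determine the
    position in the cycle.  Such positions cost log((j+1)/j) in pass j, and
    the sum over the passes telescopes to log n.  Level n has n 2^n bits
    and costs O(2^n log n). *)
Require Import Defs.
From Stdlib Require Import Reals Lra IndefiniteDescription.
From Coquelicot Require Import Coquelicot.
From mathcomp Require Import all_boot perm zify_ssreflect.

Set Implicit Arguments.
Unset Strict Implicit.
Unset Printing Implicit Defensive.

Local Open Scope nat_scope.

(* MathComp rebinds the key [R] to its ring scope. *)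
Delimit Scope R_scope with R.

(** * Windows of a binary sequence *)

Definition win (f : binseq) (l p : nat) : seq bool := mkseq (fun k => f (p + k)) l.

Lemma size_win f l p : size (win f l p) = l.
Proof. exact: size_mkseq. Qed.

Lemma nth_win f l p k : k < l -> nth false (win f l p) k = f (p + k).
Proof. by move=> lt_kl; rewrite nth_mkseq. Qed.

Lemma eq_win f g l p q :
  (forall k, k < l -> f (p + k) = g (q + k)) -> win f l p = win g l q.
Proof.
move=> fg; apply: (@eq_from_nth _ false); rewrite ?size_win // => k lt_kl.
by rewrite !nth_win ?fg.
Qed.

Lemma win_inj f g l p q k :
  win f l p = win g l q -> k < l -> f (p + k) = g (q + k).
Proof. by move=> fg lt_kl; rewrite -(nth_win f p lt_kl) fg nth_win. Qed.

Lemma sub_win f g l p q l' e :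
  win f l p = win g l q -> e + l' <= l -> win f l' (p + e) = win g l' (q + e).
Proof.
move=> fg le_el; apply: eq_win => k lt_kl.
by rewrite -!addnA; apply: (win_inj fg); lia.
Qed.

Lemma pref_win S m : pref S m = win S m 0.
Proof. by []. Qed.

Lemma win_cat f l l' p : win f (l + l') p = win f l p ++ win f l' (p + l).
Proof.
apply: (@eq_from_nth _ false); first by rewrite size_cat !size_win.
move=> k; rewrite size_win => lt_k.
rewrite nth_cat size_win nth_win //; case: ltnP => h.
  by rewrite nth_win.
by rewrite nth_win; [congr f; lia | lia].
Qed.

Lemma win_rcons f l p : win f l.+1 p = rcons (win f l p) (f (p + l)).
Proof. by rewrite -addn1 win_cat -cats1 /= /win /mkseq /= addn0. Qed.

Lemma take_win f l l' p : l' <= l -> take l' (win f l p) = win f l' p.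
Proof.
by move=> le_l; rewrite -(subnKC le_l) win_cat take_size_cat ?size_win.
Qed.

Lemma drop_win f l l' p : drop l' (win f l p) = win f (l - l') (p + l').
Proof.
case: (leqP l' l) => h.
  by rewrite -{1}(subnKC h) win_cat drop_size_cat ?size_win.
by rewrite drop_oversize ?size_win ?(ltnW h) // (eqP (ltnW h : l - l' == 0)).
Qed.

(** * De Bruijn sequences *)

Definition is_de_bruijn (n : nat) (d : binseq) : Prop :=
  [/\ forall p, d (p + 2 ^ n) = d p,
      forall p q, p < 2 ^ n -> q < 2 ^ n -> win d n p = win d n q -> p = q
    & forall w, size w = n -> exists2 p, p < 2 ^ n & win d n p = w].

Section DeBruijn.
Variable n : nat.
Let T := n.+1.-tuple bool.
Implicit Types (s : {perm T}) (x y z : T).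

Definition flip_fst (x : T) : T := [tuple of ~~ thead x :: [tuple of behead x]].
(** Such an [s] covers the de Bruijn graph by disjoint cycles; a cover by a single cycle amounts to
    a de Bruijn sequence. *)
Definition shifts s := [forall x, take n (s x) == behead x].

Lemma behead_flip x : behead (flip_fst x) = behead x.
Proof. by []. Qed.

Lemma flip_neq x : flip_fst x != x.
Proof.
apply/eqP => /(congr1 (@thead _ _)); rewrite theadE.
by case: (thead x).
Qed.

Lemma shiftsP s x : shifts s -> take n (s x) = behead x.
Proof. by move=> /forallP/(_ x)/eqP. Qed.

Lemma rot_tuple_inj : injective (fun x : T => [tuple of rot 1 x]).
Proof. by move=> x y /(congr1 val) /= /rot_inj; apply: val_inj. Qed.

Lemma shifts_rot : shifts (perm rot_tuple_inj).
Proof.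
apply/forallP => x; rewrite permE /=.
case: x => -[|a x] //= /eqP [sx].
by rewrite rot1_cons /= -cats1 take_cat -sx ltnn subnn take0 cats0.
Qed.

(** Exchanging the successors of two words is harmless when the words share their tail, as [x] and
    [flip_fst x] do. *)
Lemma shifts_tperm s x y :
  behead x = behead y -> shifts s -> shifts (tperm x y * s)%g.
Proof.
move=> xy shs; apply/forallP => z; rewrite permM shiftsP //.
by case: tpermP => [->|->|_ _]; rewrite ?xy.
Qed.

(* Two cycles through [x] and [flip_fst x] could be merged by exchanging the
   successors of these two words. *)
Lemma exists_single_cycle :
  exists2 s, shifts s & forall x, x \in porbit s (flip_fst x).
Proof.
pose s0 := perm rot_tuple_inj.
(* Take the fewest cycles: if [x] and [flip_fst x] lay on different ones, the exchange would leave
   one cycle less. *)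
case: (@arg_minnP _ s0 shifts (fun s => #|porbits s|) shifts_rot) => s shs mins.
exists s => // x; apply/negPn/negP => xn.
have /= := porbits_mul_tperm s x (flip_fst x).
rewrite xn eq_sym flip_neq /= => e.
have := mins _ (shifts_tperm (esym (behead_flip x)) shs).
rewrite leqNgt => /negP []; rewrite -(ltn_add2r 1) -e.
by rewrite -[_.*2]/2 ltn_add2l.
Qed.

(** The cycle of [x0] is closed under both ways of appending a bit, so the bits of [y] can be
    appended one after another. *)
Lemma single_cycle_full s x0 :
  shifts s -> (forall x, x \in porbit s (flip_fst x)) ->
  forall y, y \in porbit s x0.
Proof.
move=> shs hflip y.
have flip_in z : z \in porbit s x0 -> flip_fst z \in porbit s x0.
  by rewrite -!eq_porbit_mem => /eqP <-; rewrite eq_porbit_mem porbit_sym.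
have s_in z : z \in porbit s x0 -> s z \in porbit s x0.
  rewrite -!eq_porbit_mem => /eqP <-; rewrite eq_porbit_mem.
  exact: (mem_porbit s 1).
(* Invariant: after [k] steps the last [k] bits of the word reached are the first [k] bits of
   [y]. *)
suff H k : k <= n.+1 ->
    exists2 z, z \in porbit s x0 & drop (n.+1 - k) z = take k y.
  have [z zin] := H n.+1 (leqnn _).
  by rewrite subnn drop0 take_oversize ?size_tuple // => /val_inj <-.
elim: k => [|k IHk] le_k.
  by exists x0; rewrite ?porbit_id // subn0 take0 drop_oversize ?size_tuple.
have [z zin ez] := IHk (ltnW le_k).
have sE (w : T) : s w = rcons (behead w) (last false (s w)) :> seq bool.
  rewrite -(shiftsP w shs).
  have : size (s w) = n.+1 by rewrite size_tuple.
  case/lastP: (tval (s w)) => // q b; rewrite size_rcons => -[<-].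
  by rewrite last_rcons -cats1 take_size_cat // cats1.
have key (w : T) : behead w = behead z -> last false (s w) = nth false y k ->
    drop (n.+1 - k.+1) (s w) = take k.+1 y.
  move=> wz e; rewrite sE wz e (take_nth false) ?size_tuple // -ez.
  rewrite subSS drop_rcons; last by rewrite size_behead size_tuple; lia.
  by rewrite -drop1 drop_drop; congr (rcons (drop _ _) _); lia.
case: (last false (s z) =P nth false y k) => e.
  by exists (s z); [apply: s_in | apply: key].
(* By injectivity of [s] the successors of [z] and [flip_fst z] differ, and they can differ only in
   the last bit. *)
exists (s (flip_fst z)); first exact/s_in/flip_in.
apply: key => //.
have : last false (s (flip_fst z)) <> last false (s z).
  move=> e2; have /val_inj/perm_inj/eqP : val (s (flip_fst z)) = val (s z).
    by rewrite [LHS]sE [RHS]sE behead_flip e2.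
  by rewrite (negPf (flip_neq z)).
by move: e; case: (last _ (s z)); case: (last _ _); case: (nth _ _ _); congruence.
Qed.

Lemma de_bruijn_exists_succ : exists d, is_de_bruijn n.+1 d.
Proof.
have [s shs hflip] := exists_single_cycle.
pose x0 : T := [tuple of nseq n.+1 false].
have full := single_cycle_full x0 shs hflip.
have card_orb : #|porbit s x0| = 2 ^ n.+1.
  rewrite -card_bool -(card_tuple n.+1 bool).
  by apply: eq_card => y; rewrite full.
(* First bits along the cycle; by the shift property the window at [p] is the [p]-th word of the
   cycle. *)
pose d p := head false (iter p s x0).
have nth_iter (z : T) k : k < n.+1 -> nth false z k = head false (iter k s z).
  elim: k z => [|k IHk] z lt_k; first by rewrite nth0.
  rewrite iterSr -IHk; last exact: ltnW.
  rewrite -[RHS](nth_take false (n0 := n)) // (shiftsP z shs).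
  by rewrite nth_behead.
have winE p : win d n.+1 p = iter p s x0.
  apply: (@eq_from_nth _ false); rewrite size_win ?size_tuple // => k lt_k.
  by rewrite nth_win // nth_iter // /d addnC iterD.
have surj w : size w = n.+1 -> exists2 p, p < 2 ^ n.+1 & win d n.+1 p = w.
  move=> /eqP sw; have := full (Tuple sw).
  rewrite porbit_traject card_orb => /trajectP [p lt_p e].
  by exists p => //; rewrite winE -e.
(* The windows of one period cover all words of length [n.+1], of which there are equally many, so
   no window repeats. *)
have uq : uniq [seq win d n.+1 p | p <- iota 0 (2 ^ n.+1)].
  pose s1 : seq (seq bool) := [seq tval x | x <- enum {: T}].
  apply: (@leq_size_uniq _ s1).
  - by rewrite map_inj_uniq ?enum_uniq //; apply: val_inj.
  - move=> w /mapP [x _ ->]; have [p lt_p <-] := surj x (size_tuple x).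
    by apply: map_f; rewrite mem_iota.
  - by rewrite (size_map (@tval _ _)) -cardE card_tuple card_bool size_map size_iota.
exists d; split=> // [p | p q lt_p lt_q e].
  by rewrite /d iterD -card_orb iter_porbit.
apply/eqP.
have := nth_uniq [::] (s := [seq win d n.+1 p | p <- iota 0 (2 ^ n.+1)]) (i := p) (j := q).
rewrite size_map size_iota => /(_ lt_p lt_q uq) <-.
by rewrite !(nth_map 0) ?size_iota // !nth_iota // !add0n e.
Qed.

End DeBruijn.

Lemma de_bruijn_exists n : exists d, is_de_bruijn n d.
Proof.
case: n => [|n]; last exact: de_bruijn_exists_succ.
by exists (fun=> false); split=> // [[|p] [|q]|[|? ?]] //; exists 0.
Qed.

(** * Occurrences of words and PPM* probabilities *)

Lemma count_add (a : pred nat) p N :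
  count a (iota 0 (p + N)) = count a (iota 0 p) + count (fun i => a (p + i)) (iota 0 N).
Proof.
by rewrite iotaD count_cat add0n -[p in iota p N]addn0 iotaDl count_map.
Qed.

Lemma count_iota_mono (a : pred nat) p q : p <= q ->
  count a (iota 0 p) <= count a (iota 0 q) <= count a (iota 0 p) + (q - p).
Proof.
move=> /subnKC {1 2}<-; rewrite count_add leq_addr leq_add2l /=.
by apply: leq_trans (count_size _ _) _; rewrite size_iota.
Qed.

Lemma occ_pref S w m :
  occ w (pref S m) = count (fun p => win S (size w) p == w) (iota 0 (m.+1 - size w)).
Proof.
rewrite /occ pref_win size_win; case: (leqP (size w) m) => le_w.
  rewrite subSn //; apply: eq_in_count => p; rewrite mem_iota /= add0n => lt_p.
  by rewrite drop_win add0n take_win //; lia.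
rewrite (eqP (le_w : m.+1 - size w == 0)) (eqP (ltnW le_w : m - size w == 0)) /= addn0.
rewrite drop0 take_oversize ?size_win ?(ltnW le_w) //.
by case: eqP => // /(congr1 size); rewrite size_win => e; rewrite e ltnn in le_w.
Qed.

Lemma count_ge (a : pred nat) N s :
  uniq s -> (forall p, p \in s -> p < N /\ a p) -> size s <= count a (iota 0 N).
Proof.
move=> us hs; rewrite -size_filter; apply: uniq_leq_size => // p /hs [lt_p ap].
by rewrite mem_filter mem_iota ap.
Qed.

Lemma occ_catl S u w m : occ (u ++ w) (pref S m) <= occ w (pref S m).
Proof.
rewrite !occ_pref size_cat.
case: (leqP (size u + size w) m.+1) => h; last by rewrite (eqP (ltnW h : _ - _ == 0)).
have -> : m.+1 - size w = size u + (m.+1 - (size u + size w)) by lia.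
rewrite count_add; apply: leq_trans (leq_addl _ _).
apply: sub_count => p /=; rewrite win_cat eqseq_cat ?size_win //.
by rewrite addnC => /andP [].
Qed.

Lemma occ_catr S u w m : occ (u ++ w) (pref S m) <= occ u (pref S m).
Proof.
rewrite !occ_pref size_cat.
have le : m.+1 - (size u + size w) <= m.+1 - size u by lia.
have /andP [h _] := count_iota_mono (fun p => win S (size u) p == u) le.
apply: leq_trans h; apply: sub_count => p /=.
by rewrite win_cat eqseq_cat ?size_win // => /andP [].
Qed.

Lemma occ_gt0P S w m :
  reflect (exists2 p, p + size w <= m & win S (size w) p = w) (0 < occ w (pref S m)).
Proof.
rewrite occ_pref -has_count; apply: (iffP hasP) => -[p].
  by rewrite mem_iota /= add0n => lt_p /eqP e; exists p => //; lia.
by move=> le_p /eqP e; exists p => //; rewrite mem_iota /= add0n; lia.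
Qed.

(** Applied to the lengths of the stored suffixes, which form an initial segment. *)
Lemma filter_iota_closed (P : pred nat) N :
  P 0 -> (forall k k', k' <= k -> k <= N -> P k -> P k') ->
  exists r, [/\ r <= N, [seq k <- iota 0 N.+1 | P k] = iota 0 r.+1
    & forall k, k <= N -> P k = (k <= r)].
Proof.
move=> P0; elim: N => [|N IHN] down.
  by exists 0; split=> //= [|k]; rewrite ?P0 // leqn0 => /eqP ->.
have [k k' h h'|r [le_r er hr]] := IHN; first by apply: down h _; apply: leqW.
rewrite -[N.+2]addn1 iotaD filter_cat er add0n [filter _ (iota N.+1 1)]/=; case PN: (P N.+1).
  have eN : r = N.
    by apply/eqP; rewrite eqn_leq le_r -hr // (down N.+1).
  exists N.+1; split=> // [|k le_k].
    by rewrite eN -[in RHS](addn1 N.+1) iotaD.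
  by rewrite le_k (down N.+1).
exists r; rewrite cats0; split=> // [|k]; first exact: leqW.
rewrite leq_eqVlt ltnS => /orP [/eqP ->|]; last exact: hr.
by rewrite PN leqNgt ltnS le_r.
Qed.

Section PPM.
Variables (S : binseq) (q : nat).
Let x := pref S q.
Let ctx k := ctx_suffix k x.

Lemma ctxE k : k <= q -> ctx k = win S k (q - k).
Proof.
by move=> le_k; rewrite /ctx /ctx_suffix /x pref_win size_win drop_win subKn.
Qed.

Lemma size_ctx k : k <= q -> size (ctx k) = k.
Proof. by move=> le_k; rewrite ctxE // size_win. Qed.

Lemma ctx_cat k k' : k' <= k -> k <= q -> ctx k = win S (k - k') (q - k) ++ ctx k'.
Proof.
move=> le_k' le_k; rewrite !ctxE //; last exact: leq_trans le_k.
by rewrite -{1}(subnK le_k') win_cat; congr (_ ++ win _ _ _); lia.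
Qed.

Lemma cnt_ctx_mono k k' b : k' <= k -> k <= q -> cnt (ctx k) b x <= cnt (ctx k') b x.
Proof.
by move=> le_k' le_k; rewrite /cnt (ctx_cat le_k' le_k) rcons_cat occ_catl.
Qed.

Lemma tot_ctx_mono k k' : k' <= k -> k <= q -> tot (ctx k) x <= tot (ctx k') x.
Proof. by move=> le_k' le_k; rewrite leq_add // cnt_ctx_mono. Qed.

Lemma tot_gt0 c y : (0 < tot c y) = (0 < esc c y).
Proof. by rewrite /tot /esc; case: (cnt _ false _) (cnt _ true _) => [|?] [|?]. Qed.

(** For suffixes the requirement of two occurrences is automatic: if [ctx k] is followed by a bit
    somewhere, it occurs there and once more at the end of [x]. *)
Lemma stored_ctx k : 0 < k <= q -> stored (ctx k) x = (0 < tot (ctx k) x).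
Proof.
move=> /andP [k0 le_k]; have sc := size_ctx le_k.
have -> : stored (ctx k) x = (1 < occ (take (size (ctx k)).-1 (ctx k)) x) && (0 < tot (ctx k) x).
  by rewrite /stored; case: (ctx k) sc => // e; rewrite -e in k0.
case: posnP => [//|t0]; first by rewrite andbF.
rewrite andbT sc.
have [b cb] : exists b, 0 < occ (rcons (ctx k) b) x.
  move: t0; rewrite /tot addn_gt0 => /orP [h|h]; first by exists false.
  by exists true.
have /occ_gt0P [p] := cb; rewrite size_rcons sc win_rcons => le_p.
move=> /eqP; rewrite eqseq_rcons => /andP [/eqP ep _].
have st : size (take k.-1 (ctx k)) = k.-1 by rewrite size_takel // sc leq_pred.
rewrite occ_pref st; apply: (@count_ge _ _ [:: p; q - k]).
  by rewrite /= inE andbT; apply/eqP; lia.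
move=> p'; rewrite !inE => /orP [] /eqP ->; split; try lia.
  by rewrite -ep take_win // leq_pred.
by rewrite ctxE // take_win // leq_pred.
Qed.

Lemma relevant_iota : exists r, [/\ r <= q, relevant x = iota 0 r.+1
  & forall k, 0 < k <= q -> (0 < tot (ctx k) x) = (k <= r)].
Proof.
have sx : size x = q by rewrite /x size_mkseq.
have [||r [le_r er hr]] := @filter_iota_closed (fun k => stored (ctx k) x) q.
- by rewrite /ctx /ctx_suffix subn0 drop_size.
- move=> k [|k'] le_k' le_k; first by rewrite /ctx /ctx_suffix subn0 drop_size.
  rewrite !stored_ctx ?(leq_trans le_k') //=; last by rewrite le_k (leq_ltn_trans _ le_k').
  by move/leq_trans; apply; apply: tot_ctx_mono.
exists r; split=> //; first by rewrite /relevant sx.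
by move=> k /andP [k0 le_k]; rewrite -hr // stored_ctx // k0.
Qed.

(** Since the relevant lengths are 0 to [r], the escape chain loses one bit of context at a time. *)
Lemma current_spec b : exists r, let k := current x in
  [/\ k <= r <= q, forall i, 0 < i <= q -> (0 < tot (ctx i) x) = (i <= r),
      forall i, i < k -> ~~ deterministic x i,
      deterministic x k || (k == r)
    & ppm_prob_bit x b = ppm_chain x (k :: rev (iota 0 k)) b].
Proof.
have [r [le_r er hr]] := relevant_iota; exists r => k.
have [le_kr nd dr] : [/\ k <= r, forall i, i < k -> ~~ deterministic x i
    & deterministic x k || (k == r)].
  rewrite /k /current er; case: ifP => hd.
    have lt_f : find (deterministic x) (iota 0 r.+1) < r.+1.
      by rewrite -{2}(size_iota 0 r.+1) -has_find.
    rewrite nth_iota // add0n -ltnS; split=> // [i lt_i|].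
      have := before_find 0 lt_i; rewrite nth_iota ?add0n; first by move=> ->.
      exact: ltn_trans lt_f.
    by have := nth_find 0 hd; rewrite nth_iota // add0n => ->.
  have -> : last 0 (iota 0 r.+1) = r by rewrite -addn1 iotaD last_cat.
  split=> // [i lt_i|]; last by rewrite eqxx orbT.
  apply: contraFN hd => di; apply/hasP; exists i => //.
  by rewrite mem_iota /= add0n ltnW.
split=> //; first by rewrite le_kr.
rewrite /ppm_prob_bit er -/k -[r](subnKC le_kr) -addSn iotaD filter_cat.
rewrite (_ : [seq i <- iota 0 k.+1 | i <= k] = iota 0 k.+1); last first.
  by apply/all_filterP/allP => i; rewrite mem_iota.
rewrite (_ : [seq i <- iota _ _ | i <= k] = [::]).
  by rewrite cats0 -[k.+1]addn1 iotaD rev_cat.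
apply/eqP; rewrite -[_ == _]negbK -has_filter; apply/hasP => -[i].
by rewrite mem_iota /=; lia.
Qed.

Lemma freq_lower f T e N : 0 < f -> T <= N -> 0 < e <= 2 ->
  (/ INR (N + 2) <= INR f / INR (T + e))%R.
Proof.
move=> f0 le_T /andP [e0 e2].
have te0 : (0 < INR (T + e))%R by apply: lt_0_INR; apply/ltP; lia.
have le1 : (INR (T + e) <= INR (N + 2))%R by apply: le_INR; apply/leP; lia.
have le2 : (1 <= INR f)%R by rewrite -[1%R]/(INR 1); apply: le_INR; apply/leP.
apply: Rle_trans (Rinv_le_contravar _ _ te0 le1) _.
rewrite -[X in (X <= _)%R]Rmult_1_l; apply: Rmult_le_compat_r => //.
exact/Rlt_le/Rinv_0_lt_compat.
Qed.

Lemma esc_le2 c y : esc c y <= 2.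
Proof. by rewrite /esc; case: (0 < _); case: (0 < _). Qed.

(** At most one escape precedes the bit. After it the next shorter context is not deterministic, by
    choice of the current one, and not unseen, so it has been followed by both bits. If the current
    context is empty, the factor 1/2 follows the escape instead. *)
Lemma ppm_prob_bit_lower b N :
  (forall k, (current x).-1 <= k <= q -> tot (ctx k) x <= N) ->
  (/ (2 * INR (N + 2) ^ 2) <= ppm_prob_bit x b)%R.
Proof.
have [r [/andP [le_kr le_r] hr nd _ ->]] := current_spec b.
move: (current x) le_kr nd => k le_kr nd hN.
have n2 : (2 <= INR (N + 2))%R.
  by rewrite -[2%R]/(INR 2); apply: le_INR; apply/leP; lia.
have i0 : (0 < / INR (N + 2))%R by apply: Rinv_0_lt_compat; lra.
have i1 : (/ INR (N + 2) <= 1)%R.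
  by rewrite -Rinv_1; apply: Rinv_le_contravar; lra.
have -> : (/ (2 * INR (N + 2) ^ 2) = / INR (N + 2) * (/ INR (N + 2) * (1 / 2)))%R.
  by field; lra.
have tk : tot (ctx k) x <= N by apply: hN; lia.
rewrite /=; case: ifP => [f0|/negbT]; rewrite -/(ctx k).
  apply: Rle_trans (freq_lower (N := N) f0 tk _); first by nra.
  rewrite esc_le2 andbT -tot_gt0 /tot.
  by case: b f0; rewrite -/(ctx k) => f0; rewrite addn_gt0 f0 ?orbT.
rewrite -eqn0Ngt => /eqP fk0; apply: Rmult_le_compat; try nra.
  case: eqP => [//|/eqP t0]; apply: freq_lower => //; rewrite ?esc_le2 ?andbT -tot_gt0 lt0n //.
case: k le_kr nd hN tk fk0 => [|k] le_kr nd hN tk fk0; first by rewrite /=; nra.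
have tk1 : tot (ctx k) x <= N by apply: hN => /=; lia.
have t0 : 0 < tot (ctx k.+1) x by rewrite hr //; lia.
have {}t0 : 0 < tot (ctx k) x by apply: leq_trans t0 (tot_ctx_mono _ _) => //; lia.
have := nd k (leqnn _); rewrite /deterministic -/(ctx k) => e1.
have : 0 < esc (ctx k) x by rewrite -tot_gt0.
rewrite -[k.+1]addn1 iotaD rev_cat /= add0n -/(ctx k) => e0.
have f0 : 0 < cnt (ctx k) b x.
  by move: e0 e1; rewrite /esc; case: b {fk0}; case: (cnt _ _ _) (cnt _ _ _) => [|?] [|?].
rewrite f0; apply: Rle_trans (freq_lower (N := N) f0 tk1 _); first by nra.
by rewrite e0 esc_le2.
Qed.

(** The context of length [K] is deterministic, so the current one is deterministic and not longer.
    Being a suffix, it has a count [f] of [b] with f >= j, and f / (f + 1) increases with f. *)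
Lemma ppm_prob_bit_repeat b K j : 0 < j -> K <= q ->
  j <= cnt (ctx K) b x -> cnt (ctx K) (~~ b) x = 0 ->
  (INR j / INR j.+1 <= ppm_prob_bit x b)%R.
Proof.
move=> j0 le_K le_j c0.
have [r [/andP [le_kr le_r] hr nd dr ->]] := current_spec b.
move: (current x) le_kr nd dr => k le_kr nd dr.
have escE c : 0 < cnt c b x -> (esc c x == 1) = (cnt c (~~ b) x == 0).
  by rewrite /esc; case: (b) => /= ->; case: (cnt _ _ _).
have cK : 0 < cnt (ctx K) b x by apply: leq_trans le_j.
have dK : deterministic x K by rewrite /deterministic escE // c0.
have le_kK : k <= K by rewrite leqNgt; apply/negP => /nd; rewrite dK.
have le_Kr : K <= r.
  case: (posnP K) => [-> //|K0]; rewrite -hr ?K0 // /tot.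
  by move: cK; case: (b) => h; rewrite addn_gt0 h ?orbT.
have dk : deterministic x k.
  case/orP: dr => // /eqP ek; suff -> : k = K by [].
  by apply/eqP; rewrite eqn_leq le_kK ek.
have ck : j <= cnt (ctx k) b x by apply: leq_trans le_j (cnt_ctx_mono _ _ _).
have ck0 : 0 < cnt (ctx k) b x by apply: leq_trans ck.
have ek : esc (ctx k) x = 1 by apply/eqP.
have tk : tot (ctx k) x = cnt (ctx k) b x.
  move: dk; rewrite /deterministic -/(ctx k) escE // => /eqP.
  by rewrite /tot; case: (b) => ->; rewrite ?addn0.
rewrite S_INR [ppm_chain _ _ _]/= -/(ctx k) ck0 tk ek addn1 S_INR.
have h1 : (1 <= INR j)%R by rewrite -[1%R]/(INR 1); apply: le_INR; apply/leP.
have h2 : (INR j <= INR (cnt (ctx k) b x))%R by apply: le_INR; apply/leP.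
have divE r0 : (1 <= r0 -> r0 / (r0 + 1) = 1 - / (r0 + 1))%R by move=> ?; field; lra.
rewrite !divE; try lra.
have : (/ (INR (cnt (ctx k) b x) + 1) <= / (INR j + 1))%R.
  by apply: Rinv_le_contravar; lra.
by lra.
Qed.

End PPM.

(** * The sequence and its blocks *)

(** Level [n] is read in two ways: as 2^n blocks of [n] bits for LZ78, and as [n] passes of 2^n bits
    for word counts and PPM*. *)
Fixpoint level_start (n : nat) : nat :=
  if n is k.+1 then level_start k + k * 2 ^ k else 0.
Arguments level_start : simpl never.

Lemma level_startS n : level_start n.+1 = level_start n + n * 2 ^ n.
Proof. by []. Qed.

Lemma level_start_mono m n : m <= n -> level_start m <= level_start n.
Proof.
move=> /subnKC <-; elim: (n - m) => [|k IHk]; first by rewrite addn0.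
by rewrite addnS level_startS; apply: leq_trans IHk (leq_addr _ _).
Qed.

Lemma level_start_inv p n q : p < level_start n -> level_start q <= p -> q < n.
Proof.
move=> lt_p le_q; rewrite ltnNge; apply/negP => /level_start_mono.
by move=> /(leq_trans lt_p); rewrite ltnNge le_q.
Qed.

Lemma level_start_ge n : n <= level_start n.+1.
Proof. by rewrite level_startS; have := expn_gt0 2 n; nia. Qed.

Lemma level_start_upper n : level_start n.+1 <= n * 2 ^ n.+1.
Proof.
elim: n => [|n IHn] //; rewrite level_startS.
by move: IHn; rewrite !expnS; nia.
Qed.

Lemma level_start_lower n : n * 2 ^ n <= level_start n.+1.
Proof. by rewrite level_startS leq_addl. Qed.

Lemma find_iota (a : pred nat) m n :
  n < m -> a n -> (forall k, k < n -> ~~ a k) -> find a (iota 0 m) = n.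
Proof.
move=> lt_nm an hk; apply/eqP; rewrite eqn_leq; apply/andP; split.
  rewrite leqNgt; apply/negP => h; have := before_find 0 h.
  by rewrite nth_iota // add0n an.
have ha : has a (iota 0 m) by apply/hasP; exists n; rewrite ?mem_iota.
rewrite leqNgt; apply/negP => h; have := nth_find 0 ha.
by rewrite nth_iota ?add0n ?(negPf (hk _ h)) //; apply: ltn_trans lt_nm.
Qed.

(** The search range is long enough by [level_start_ge]. *)
Definition level (p : nat) := find (fun n => p < level_start n.+1) (iota 0 p.+2).

Lemma levelE n q : q < n * 2 ^ n -> level (level_start n + q) = n.
Proof.
move=> lt_q; apply: find_iota.
- by case: n lt_q => [|n] // _; have := level_start_ge n; lia.
- by rewrite level_startS ltn_add2l.
- move=> k lt_k; rewrite -leqNgt; apply: leq_trans (leq_addr _ _).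
  exact: level_start_mono.
Qed.

Lemma level_ex p : exists n, level_start n <= p < level_start n.+1.
Proof.
have ex : exists n, p < level_start n by exists p.+2; apply: level_start_ge.
case: (ex_minnP ex) => -[|n] // lt_p min_n.
by exists n; rewrite lt_p andbT leqNgt; apply/negP => /min_n; rewrite ltnn.
Qed.

(** The quotient counts the one-step shifts of the cycle made so far in the level. *)
Definition level_seq (S : binseq) (d : nat -> binseq) : Prop :=
  forall n q, q < n * 2 ^ n -> S (level_start n + q) = d n (q + q %/ lcmn n (2 ^ n)).

Lemma level_seq_exists d : exists S, level_seq S d.
Proof.
exists (fun p => let n := level p in let q := p - level_start n in
  d n (q + q %/ lcmn n (2 ^ n))) => n q lt_q /=.
by rewrite levelE // addKn.
Qed.

Section Sequence.
Variables (d : nat -> binseq) (S : binseq).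
Hypothesis dB : forall n, is_de_bruijn n (d n).
Hypothesis SE : level_seq S d.
Local Notation M := level_start.
Local Notation L n := (lcmn n (2 ^ n)).

Let exp2_gt0 n : 0 < 2 ^ n. Proof. exact: expn_gt0. Qed.

Lemma d_period n p j : d n (p + j * 2 ^ n) = d n p.
Proof.
have [per _ _] := dB n.
by elim: j => [|j IHj]; rewrite ?addn0 // mulSn addnCA addnC per.
Qed.

Lemma d_mod n p : d n (p %% 2 ^ n) = d n p.
Proof. by rewrite {2}(divn_eq p (2 ^ n)) addnC d_period. Qed.

Lemma win_d_mod n l p : win (d n) l (p %% 2 ^ n) = win (d n) l p.
Proof.
apply: eq_win => k _; rewrite -d_mod modnDml d_mod //.
Qed.

Lemma win_d_inj n p q :
  p < 2 ^ n -> q < 2 ^ n -> win (d n) n p = win (d n) n q -> p = q.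
Proof. by have [_ inj _] := dB n; apply: inj. Qed.

Lemma win_d_surj n w : size w = n -> exists2 p, p < 2 ^ n & win (d n) n p = w.
Proof. by have [_ _ surj] := dB n; apply: surj. Qed.

(** * Passes and blocks within a level *)

Definition shift (n j : nat) := (j * 2 ^ n) %/ L n.

Lemma L_gt0 n : 0 < n -> 0 < L n.
Proof. by move=> n0; rewrite lcmn_gt0 n0 exp2_gt0. Qed.

(** A level consists of gcd(n, 2^n) stretches of length [L n], with a shift between consecutive
    ones. *)
Lemma div_L_lt n q : 0 < n -> q < n * 2 ^ n -> q %/ L n < gcdn n (2 ^ n).
Proof. by move=> n0 lt_q; rewrite ltn_divLR ?L_gt0 // mulnC muln_lcm_gcd. Qed.

Lemma shift_lt n j : j < n -> shift n j < n.
Proof.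
move=> lt_j; have n0 : 0 < n by apply: leq_ltn_trans lt_j.
apply: leq_trans (dvdn_leq n0 (dvdn_gcdl n (2 ^ n))).
by apply: div_L_lt; rewrite // ltn_pmul2r.
Qed.

(** Shifts happen only at multiples of [L n], hence of 2^n, so none falls inside a pass. *)
Lemma S_pass n j i : j < n -> i < 2 ^ n ->
  S (M n + j * 2 ^ n + i) = d n (shift n j + i).
Proof.
move=> lt_j lt_i; rewrite -addnA SE; last first.
  by apply: (@leq_trans (j.+1 * 2 ^ n)); rewrite ?leq_mul2r ?lt_j ?orbT // mulSn addnC ltn_add2r.
have -> : (j * 2 ^ n + i) %/ L n = shift n j.
  rewrite /shift; case/dvdnP: (dvdn_lcmr n (2 ^ n)) => c ->.
  by rewrite (mulnC c) !divnMA divnMDl // (divn_small lt_i) addn0 mulnK.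
by rewrite -addnA addnC d_period addnC.
Qed.

Lemma win_pass n j i l : j < n -> i + l <= 2 ^ n ->
  win S l (M n + j * 2 ^ n + i) = win (d n) l (shift n j + i).
Proof.
by move=> lt_j le_l; apply: eq_win => k lt_k; rewrite -!addnA addnA S_pass //; lia.
Qed.

Lemma win_block n i : 0 < n -> i < 2 ^ n ->
  win S n (M n + n * i) = win (d n) n (n * i + (n * i) %/ L n).
Proof.
move=> n0 lt_i; apply: eq_win => k lt_k.
have ltq : n * i + k < n * 2 ^ n.
  by apply: (@leq_trans (n * i.+1)); rewrite ?leq_mul2l ?lt_i ?orbT // mulnS addnC ltn_add2r.
rewrite -addnA SE //; congr d.
(* [L n] is also a multiple of [n], so no shift falls inside a block. *)
suff -> : (n * i + k) %/ L n = (n * i) %/ L n by lia.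
case/dvdnP: (dvdn_lcml n (2 ^ n)) => c ->.
by rewrite (mulnC c) !divnMA mulKn // mulnC divnMDl // (divn_small lt_k) addn0.
Qed.

(** Equal blocks start at cycle positions n i + a and n i' + a' congruent modulo 2^n, where [a] and
    [a'] count the shifts. Reduction modulo gcd(n, 2^n), which exceeds both counts, gives a = a'.
    Then n (i' - i) is a multiple of [L n], while both blocks lie in the same stretch of length
    [L n]. *)
Lemma block_inj n i i' : 0 < n -> i < 2 ^ n -> i' < 2 ^ n ->
  win S n (M n + n * i) = win S n (M n + n * i') -> i = i'.
Proof.
move=> n0; wlog le_i : i i' / i <= i'.
  move=> h lt_i lt_i' e; case: (leqP i i') => [/h|/ltnW/h] -> //.
move=> lt_i lt_i'; rewrite !win_block // -win_d_mod -[RHS]win_d_mod.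
move/win_d_inj; rewrite !ltn_mod => /(_ (exp2_gt0 n) (exp2_gt0 n)).
set a := _ %/ _; set a' := _ %/ _ => e.
have g0 : 0 < gcdn n (2 ^ n) by rewrite gcdn_gt0 n0.
have lt_a : a < gcdn n (2 ^ n) by rewrite div_L_lt // ltn_pmul2l.
have lt_a' : a' < gcdn n (2 ^ n) by rewrite div_L_lt // ltn_pmul2l.
have ea : a = a'.
  rewrite -(modn_small lt_a) -(modn_small lt_a').
  have modg q b : (n * q + b) %% 2 ^ n %% gcdn n (2 ^ n) = b %% gcdn n (2 ^ n).
    rewrite modn_dvdm ?dvdn_gcdr //; case/dvdnP: (dvdn_gcdl n (2 ^ n)) => c ec.
    have -> : n * q = c * q * gcdn n (2 ^ n) by rewrite mulnAC -ec.
    by rewrite modnMDl.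
  by rewrite -(modg i a) -(modg i' a') e.
move: e; rewrite ea => /eqP; rewrite eqn_modDr eq_sym eqn_mod_dvd ?leq_mul2l ?le_i ?orbT //.
rewrite -mulnBr => dv.
have dvL : L n %| n * (i' - i) by rewrite dvdn_lcm dv dvdn_mulr.
have small : n * (i' - i) < L n.
  rewrite mulnBr ltn_subLR ?leq_mul2l ?le_i ?orbT //.
  rewrite (divn_eq (n * i) (L n)) -/a ea (divn_eq (n * i') (L n)) -/a'.
  rewrite -addnA ltn_add2l; apply: ltn_addl; apply: ltn_pmod; exact: L_gt0.
have : n * (i' - i) == 0.
  by move: small; apply: contraLR; rewrite -lt0n -leqNgt => h; apply: dvdn_leq.
by rewrite muln_eq0 => /orP [] /eqP; lia.
Qed.

Definition bit_words (n : nat) : seq (seq bool) := map (@tval n bool) (enum {: n.-tuple bool}).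

Lemma size_bit_words n : size (bit_words n) = 2 ^ n.
Proof. by rewrite (size_map (@tval _ _)) -cardE card_tuple card_bool. Qed.

Lemma mem_bit_words n w : size w = n -> w \in bit_words n.
Proof. by move=> /eqP sw; apply/mapP; exists (Tuple sw); rewrite // mem_enum. Qed.

Lemma block_surj n w : 0 < n -> size w = n ->
  exists2 i, i < 2 ^ n & win S n (M n + n * i) = w.
Proof.
move=> n0 sw; pose s := [seq win S n (M n + n * i) | i <- iota 0 (2 ^ n)].
have us : uniq s.
  rewrite map_inj_in_uniq ?iota_uniq // => i i'; rewrite !mem_iota !add0n.
  exact: block_inj.
have ss : {subset s <= bit_words n}.
  by move=> _ /mapP [i _ ->]; apply: mem_bit_words; rewrite size_win.
have [|_ /(_ w)] := uniq_min_size us ss; first by rewrite size_bit_words size_map size_iota.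
rewrite mem_bit_words // => /mapP [i]; rewrite mem_iota => lt_i ->.
by exists i.
Qed.

(* [ph r] is the [r]-th LZ78 phrase; phrase 0, the empty word, is the initial
   dictionary entry and also the only block of level 0. *)
Definition ph_level (r : nat) := trunc_log 2 r.+1.
Definition ph_start (r : nat) := M (ph_level r) + ph_level r * (r.+1 - 2 ^ ph_level r).
Definition ph (r : nat) := win S (ph_level r) (ph_start r).

Lemma ph_level_bounds r : 2 ^ ph_level r <= r.+1 < 2 ^ (ph_level r).+1.
Proof. exact: trunc_log_bounds. Qed.

(** The levels below [n] hold 1 + 2 + ... + 2^(n-1) = 2^n - 1 phrases, the empty one included. *)
Lemma ph_levelE n i : i < 2 ^ n -> ph_level (2 ^ n - 1 + i) = n.
Proof.
by move=> lt_i; apply: trunc_log_eq => //; rewrite expnS; have := exp2_gt0 n; lia.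
Qed.

Lemma ph_startE n i : i < 2 ^ n -> ph_start (2 ^ n - 1 + i) = M n + n * i.
Proof.
move=> lt_i; rewrite /ph_start ph_levelE //; congr (_ + _); congr (_ * _).
by have := exp2_gt0 n; lia.
Qed.

Lemma ph_split r : exists n i, [/\ i < 2 ^ n, r = 2 ^ n - 1 + i & ph_level r = n].
Proof.
exists (ph_level r), (r.+1 - 2 ^ ph_level r).
have /andP [] := ph_level_bounds r; have := exp2_gt0 (ph_level r); rewrite expnS.
by split; lia.
Qed.

Lemma phE n i : i < 2 ^ n -> ph (2 ^ n - 1 + i) = win S n (M n + n * i).
Proof. by move=> lt_i; rewrite /ph ph_startE // ph_levelE. Qed.

Lemma size_ph r : size (ph r) = ph_level r.
Proof. exact: size_win. Qed.

Lemma ph_startS r : ph_start r.+1 = ph_start r + ph_level r.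
Proof.
have [n [i [lt_i -> ->]]] := ph_split r; rewrite ph_startE //.
case: (ltnP i.+1 (2 ^ n)) => h; first by rewrite -addnS ph_startE // mulnS; lia.
(* The last block of a level: the next phrase opens level [n.+1]. *)
have ei : i.+1 = 2 ^ n by lia.
have -> : (2 ^ n - 1 + i).+1 = 2 ^ n.+1 - 1 + 0 by rewrite expnS; lia.
by rewrite ph_startE // level_startS -ei muln0 mulnS; lia.
Qed.

Lemma ph_level_mono r r' : r <= r' -> ph_level r <= ph_level r'.
Proof. by move=> h; apply: leq_trunc_log. Qed.

Lemma ph_inj : injective ph.
Proof.
move=> r r'; have [n [i [lt_i -> en]]] := ph_split r.
have [n' [i' [lt_i' -> en']]] := ph_split r' => e.
have := congr1 size e; rewrite !size_ph !ph_levelE // => enn; subst n'.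
move: e; rewrite !phE //; case: n lt_i lt_i' {en en'} => [|n] lt_i lt_i'.
  by move=> _; rewrite expn0 in lt_i lt_i' *; lia.
by move/block_inj => ->.
Qed.

Lemma ph_surj w : exists2 r, ph_level r = size w & ph r = w.
Proof.
case: (posnP (size w)) => [/size0nil ->|n0]; first by exists 0.
have [i lt_i ei] := block_surj n0 erefl.
by exists (2 ^ size w - 1 + i); rewrite ?ph_levelE ?phE.
Qed.

(** * Lempel-Ziv parsing *)

Lemma size_bin m : 0 < m -> size (bin m) = (trunc_log 2 m).+1.
Proof.
suff aux f k : k <= f -> 0 < k -> size (bin_aux f k) = (trunc_log 2 k).+1.
  exact: aux.
elim: f k => [|f IHf] [|[|k]] // le_k _; first by case: f {IHf le_k}.
rewrite [bin_aux _ _]/= size_rcons IHf ?half_gt0 //; last by move: le_k; rewrite -divn2; lia.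
by rewrite (@trunc_log2S k.+2).
Qed.

Lemma mem_phrases w r : (w \in mkseq ph r) = [exists i : 'I_r, ph i == w].
Proof.
apply/mapP/existsP => [[i]|[i /eqP <-]].
  by rewrite mem_iota /= => lt_i ->; exists (Ordinal lt_i).
by exists (val i); rewrite // mem_iota /= ltn_ord.
Qed.

Lemma ph_notin r : ph r \notin mkseq ph r.
Proof.
rewrite mem_phrases; apply/existsP => -[i /eqP /ph_inj e].
by have := ltn_ord i; rewrite e ltnn.
Qed.

(** Every word is a phrase and phrases come in order of length, so all words below the current
    length have appeared. *)
Lemma phrase_short w r : size w < ph_level r -> exists2 i, i < r & ph i = w.
Proof.
have [i li ei] := ph_surj w; rewrite -li => lt_l; exists i => //.
by rewrite ltnNge; apply/negP => /ph_level_mono; rewrite leqNgt lt_l.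
Qed.

Lemma phrase_short_in w r : size w < ph_level r -> w \in mkseq ph r.
Proof.
move=> /phrase_short [i lt_i ei]; rewrite mem_phrases.
by apply/existsP; exists (Ordinal lt_i); rewrite ei.
Qed.

Lemma ph_level_gt0 r : (0 < ph_level r) = (0 < r).
Proof. by rewrite trunc_log_gt0. Qed.

Definition parent (r : nat) := index (take (ph_level r).-1 (ph r)) (mkseq ph r).

(** The proper prefixes of [ph r] are in the dictionary, being shorter than its level, and [ph r] is
    not, by injectivity of [ph]. *)
Lemma lz_parse_step f r s : 0 < r ->
  lz_parse f.+1 (mkseq ph r) (ph r ++ s) =
  (parent r, nth false (ph r) (ph_level r).-1) :: lz_parse f (mkseq ph r.+1) s.
Proof.
move=> r0; have l0 : 0 < ph_level r by rewrite ph_level_gt0.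
have takeE k : k <= ph_level r -> take k (ph r ++ s) = take k (ph r).
  by move=> le_k; rewrite takel_cat ?size_ph.
have fE : find (fun k => take k.+1 (ph r ++ s) \notin mkseq ph r)
    (iota 0 (size (ph r ++ s))) = (ph_level r).-1.
  apply: find_iota; first by rewrite size_cat size_ph; lia.
    by rewrite prednK // takeE // take_oversize ?size_ph // ph_notin.
  move=> k lt_k; rewrite takeE ?negbK; last by lia.
  apply: phrase_short_in.
  by rewrite size_take size_ph; case: ifP; lia.
have sE : minn (ph_level r).-1.+1 (size (ph r ++ s)) = ph_level r.
  by rewrite prednK // size_cat size_ph; lia.
have [b [x ex]] : exists b x, ph r ++ s = b :: x.
  case e: (ph r) (size_ph r) => [|b x] /= es; first by rewrite -es in l0.
  by exists b, (x ++ s).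
have -> : lz_parse f.+1 (mkseq ph r) (ph r ++ s) =
    let x := ph r ++ s in
    let j := find (fun k => take k.+1 x \notin mkseq ph r) (iota 0 (size x)) in
    let k := minn j.+1 (size x) in
    (index (take k.-1 x) (mkseq ph r), nth false x k.-1)
      :: lz_parse f (rcons (mkseq ph r) (take k x)) (drop k x) by rewrite ex.
cbv zeta; rewrite fE sE takeE ?leq_pred // takeE // nth_cat size_ph prednK // leqnn.
rewrite [take (ph_level r) _]take_oversize ?size_ph // drop_cat size_ph ltnn subnn drop0.
by rewrite /parent /mkseq -[r.+1]addn1 iotaD map_cat cats1.
Qed.

Lemma parentP r : 0 < r -> ph_level (parent r) = (ph_level r).-1.
Proof.
move=> r0; set w := take (ph_level r).-1 (ph r).
have l0 : 0 < ph_level r by rewrite ph_level_gt0.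
have sw : size w = (ph_level r).-1 by rewrite size_take size_ph; case: ifP; lia.
have w_in : w \in mkseq ph r by apply: phrase_short_in; rewrite sw; lia.
have e : ph (parent r) = w.
  rewrite -[RHS](nth_index [::] w_in) nth_mkseq //.
  by move: w_in; rewrite -index_mem size_mkseq.
by rewrite -sw -e size_ph.
Qed.

(** The parent is one level lower, so the number encoded by Elias delta has [ph_level r] binary
    digits. The successor on the left accounts for the bit sent with the pointer. *)
Lemma size_ptr_parent r : 0 < r ->
  (size (ptr_code (parent r))).+1 = ph_level r + (2 * size (bin (ph_level r))).-1.
Proof.
move=> r0; have l0 : 0 < ph_level r by rewrite ph_level_gt0.
have e : size (bin (parent r).+1) = ph_level r.
  by rewrite size_bin // -/(ph_level _) parentP // prednK.
rewrite /ptr_code /elias_delta size_cat e size_behead e /elias_gamma size_cat size_nseq.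
have : 0 < size (bin (ph_level r)) by rewrite size_bin.
by lia.
Qed.

Definition lz_cost f D x := size (flatten [seq ptr_code p.1 ++ [:: p.2] | p <- lz_parse f D x]).

Lemma lz_cost_step f r x : 0 < r ->
  lz_cost f.+1 (mkseq ph r) (ph r ++ x) =
  ph_level r + (2 * size (bin (ph_level r))).-1 + lz_cost f (mkseq ph r.+1) x.
Proof.
move=> r0; rewrite -size_ptr_parent // /lz_cost lz_parse_step // map_cons [flatten _]/=.
by rewrite size_cat (size_cat (ptr_code _)) addn1.
Qed.

Lemma win_ph r m : ph_start r.+1 <= m ->
  win S (m - ph_start r) (ph_start r) =
  ph r ++ win S (m - ph_start r.+1) (ph_start r.+1).
Proof.
rewrite ph_startS => le_m.
have -> : m - ph_start r = ph_level r + (m - (ph_start r + ph_level r)) by lia.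
by rewrite win_cat.
Qed.

Lemma lz_len_pref m :
  lz_len (pref S m) = lz_cost m (mkseq ph 1) (win S (m - ph_start 1) (ph_start 1)).
Proof.
have -> : ph_start 1 = 0 by [].
have -> : mkseq ph 1 = [:: [::]] by rewrite /mkseq /= (size0nil (size_ph 0)).
by rewrite /lz_len /LZ size_mkseq subn0.
Qed.

(** Each complete phrase costs at least its length; the summand [n] pays for an unfinished last
    phrase. *)
Lemma lz_cost_lower f r m n : 0 < r -> ph_start r <= m < M n.+1 -> m - ph_start r <= f ->
  m - ph_start r <= lz_cost f (mkseq ph r) (win S (m - ph_start r) (ph_start r)) + n.
Proof.
elim: f r => [|f IHf] r r0 /andP [le_m lt_m] le_f; first by apply: leq_trans le_f _.
case: (leqP (ph_start r.+1) m) => h.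
  have l0 : 0 < ph_level r by rewrite ph_level_gt0.
  rewrite win_ph // lz_cost_step //.
  have := IHf r.+1 isT; rewrite h lt_m => /(_ isT).
  by move: h; rewrite ph_startS => h; lia.
have : ph_level r < n.+1.
  by apply: (@level_start_inv m) => //; apply: leq_trans le_m; apply: leq_addr.
by move: h; rewrite ph_startS; lia.
Qed.

Lemma lz_len_lower m n : m < M n.+1 -> m <= lz_len (pref S m) + n.
Proof.
move=> lt_m; rewrite lz_len_pref.
by have := @lz_cost_lower m 1 m n isT lt_m; rewrite subn0; apply.
Qed.

(** The bound on [r + k] keeps all levels at most [n], so each of the [k] phrases exceeds its length
    by at most twice the digits of [n]. *)
Lemma lz_cost_upper n k f r : 0 < r -> r + k < 2 ^ n.+1 ->
  ph_start (r + k) - ph_start r <= f ->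
  lz_cost f (mkseq ph r) (win S (ph_start (r + k) - ph_start r) (ph_start r)) <=
  ph_start (r + k) - ph_start r + k * (2 * size (bin n)).
Proof.
elim: k f r => [|k IHk] f r r0 lt_r.
  by rewrite addn0 subnn => _; case: f.
have l0 : 0 < ph_level r by rewrite ph_level_gt0.
rewrite -addSnnS in lt_r *.
have mono r1 k1 : ph_start r1 <= ph_start (r1 + k1).
  by elim: k1 => [|k1 IH]; rewrite ?addn0 // addnS ph_startS (leq_trans IH) ?leq_addr.
have := mono r.+1 k; rewrite {1}ph_startS => mk.
case: f => [|f] le_f; first by lia.
rewrite win_ph ?mono // lz_cost_step //.
have := IHk f r.+1 isT lt_r; rewrite ph_startS => /(_ _)/=.
have le_n : ph_level r <= n.
  rewrite -ltnS -(ltn_exp2l _ _ (isT : 1 < 2)).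
  by have /andP [] := ph_level_bounds r; lia.
have : size (bin (ph_level r)) <= size (bin n).
  by rewrite !size_bin ?ltnS ?leq_trunc_log //; lia.
rewrite mulSn; lia.
Qed.

Lemma lz_len_upper n :
  lz_len (pref S (M n.+1)) <= M n.+1 + 2 ^ n.+1 * (2 * size (bin n)).
Proof.
(* Level [n.+1] opens with phrase 2^(n+1) - 1, so the nonempty phrases before it number 2^(n+1) -
   2. *)
have n0 := exp2_gt0 n; have eM : M n.+1 = ph_start (1 + (2 ^ n.+1 - 2)).
  have -> : 1 + (2 ^ n.+1 - 2) = 2 ^ n.+1 - 1 + 0 by rewrite expnS; lia.
  by rewrite ph_startE // muln0 addn0.
rewrite lz_len_pref {1 2}eM.
have := @lz_cost_upper n (2 ^ n.+1 - 2) (M n.+1) 1 isT.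
rewrite -!eM => /(_ _ _)/=; rewrite subn0 => h.
apply: leq_trans (h _ _) _ => //; first by rewrite expnS; lia.
by rewrite leq_add2l leq_mul2r leq_subr orbT.
Qed.

(** * Word frequencies *)

Lemma count_split (T : Type) (a b : pred T) s :
  count a s = count (predI a b) s + count (predI a (predC b)) s.
Proof. by elim: s => //= x s ->; case: (a x); case: (b x) => /=; lia. Qed.

(** Induction on the missing length: a full word occurs once per period, and the occurrences of a
    shorter one split by the following bit. *)
Lemma count_d n w : size w <= n ->
  count (fun p => win (d n) (size w) p == w) (iota 0 (2 ^ n)) = 2 ^ (n - size w).
Proof.
move: {2}(n - size w) (erefl (n - size w)) => k; elim: k w => [|k IHk] w ek le_w.
  have sw : size w = n by lia.
  rewrite ek sw; have [p lt_p ep] := win_d_surj sw.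
  rewrite (@eq_in_count _ _ (pred1 p)); last first.
    move=> q; rewrite mem_iota add0n => lt_q /=; rewrite -ep.
    by apply/eqP/eqP => [/win_d_inj -> //|->].
  by rewrite count_uniq_mem ?iota_uniq // mem_iota lt_p.
rewrite (count_split _ (fun p => ~~ d n (p + size w))) ek expnS mul2n -addnn.
have step b : count (fun p => (win (d n) (size w) p == w) && (d n (p + size w) == b))
    (iota 0 (2 ^ n)) = 2 ^ k.
  have -> : k = n - size (rcons w b) by rewrite size_rcons; lia.
  rewrite -(IHk (rcons w b)) ?size_rcons; try lia.
  by apply: eq_count => p; rewrite win_rcons eqseq_rcons.
congr (_ + _); [rewrite -(step false) | rewrite -(step true)];
  by apply: eq_count => p /=; case: (d n _).
Qed.

Lemma count_shift (f : pred nat) P s : (forall p, f (p + P) = f p) ->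
  count (fun i => f (s + i)) (iota 0 P) = count f (iota 0 P).
Proof.
move=> per; elim: s => [|s <-]; first exact: eq_count.
have : f (s + 0) + count (fun i => f (s + i)) (iota 1 P) =
    count (fun i => f (s + i)) (iota 0 P) + f (s + P).
  by rewrite -[LHS]/(count _ (iota 0 P.+1)) -addn1 iotaD count_cat /= addn0.
rewrite addn0 per addnC => /addIn <-.
rewrite (iotaDl 1 0) count_map; apply: eq_count => i /=.
by rewrite addSnnS.
Qed.

(** Compares a pass of [S] with the cycle: only windows running past the end of the pass can
    differ. *)
Lemma count_near (f g : pred nat) N l : (forall i, i + l <= N -> f i = g i) ->
  count f (iota 0 N) <= count g (iota 0 N) + l.
Proof.
move=> fg; case: (leqP N l) => le_l.
  by apply: leq_trans (count_size _ _) _; rewrite size_iota; lia.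
rewrite -(subnK (ltnW le_l)) iotaD !count_cat.
rewrite (@eq_in_count _ f g (iota 0 _)); last first.
  by move=> i; rewrite mem_iota /= add0n => h; apply: fg; lia.
rewrite -addnA leq_add2l; apply: leq_trans (leq_addl _ _).
by apply: leq_trans (count_size _ _) _; rewrite size_iota.
Qed.

Lemma count_d_shift n w s : size w <= n ->
  count (fun i => win (d n) (size w) (s + i) == w) (iota 0 (2 ^ n)) = 2 ^ (n - size w).
Proof.
move=> le_w; rewrite -(count_d le_w) -[RHS](count_shift s) // => p.
by congr (_ == _); apply: eq_win => k _; rewrite addnAC -[2 ^ n]mul1n d_period.
Qed.

Lemma count_pass_upper n j w : j < n ->
  count (fun i => win S (size w) (M n + j * 2 ^ n + i) == w) (iota 0 (2 ^ n))
  <= 2 ^ (n - size w) + size w.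
Proof.
move=> lt_j; pose g i := win (d n) (size w) (shift n j + i) == w.
apply: leq_trans (count_near (g := g) (l := size w) _) _.
  by move=> i le_i; rewrite /g win_pass.
rewrite leq_add2r /g; case: (leqP (size w) n) => le_w; first by rewrite count_d_shift.
(* For longer [w] the truncated exponent is 0, and already the prefix of length [n] occurs only once
   in the cycle. *)
rewrite (eqP (ltnW le_w : n - size w == 0)).
have sw : size (take n w) = n by rewrite size_takel // ltnW.
have := count_d_shift (shift n j) (eq_leq sw); rewrite sw subnn => <-.
apply: sub_count => i /= /eqP e.
by rewrite -[in take n w]e take_win // ltnW.
Qed.

Lemma count_pass_lower n j w : j < n -> size w <= n ->
  2 ^ (n - size w) <=
  count (fun i => win S (size w) (M n + j * 2 ^ n + i) == w) (iota 0 (2 ^ n)) + size w.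
Proof.
move=> lt_j le_w; rewrite -(count_d_shift (shift n j) le_w).
by apply: count_near => i le_i; rewrite win_pass.
Qed.

(** Sums a bound per pass over all passes. There are n(n-1)/2 + j of them, estimated by n * n + j.
    The constants allow both frequencies ([e] = 1) and polynomial counts ([e] = 0). *)
Lemma count_levels_upper (a : pred nat) c e b n :
  (forall k j, j < k -> k <= n ->
    c * count (fun i => a (M k + j * 2 ^ k + i)) (iota 0 (2 ^ k)) <= e * 2 ^ k + b) ->
  forall j, j <= n ->
  c * count a (iota 0 (M n + j * 2 ^ n)) <= e * (M n + j * 2 ^ n) + b * (n * n + j).
Proof.
elim: n => [|n IHn] hp.
  by move=> j; rewrite leqn0 => /eqP ->; change (M 0 + _) with 0; rewrite /= muln0.
have base : c * count a (iota 0 (M n.+1)) <= e * M n.+1 + b * (n.+1 * n.+1).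
  rewrite level_startS; apply: leq_trans (IHn _ n (leqnn n)) _.
    by move=> k j lt_j le_k; apply: hp => //; apply: leqW.
  by rewrite leq_add2l leq_mul2l; apply/orP; right; nia.
elim=> [|j IHj] le_j; first by rewrite !addn0.
rewrite mulSnr addnA count_add !mulnDr; have := IHj (ltnW le_j).
have := hp n.+1 j le_j (leqnn _); rewrite !mulnDr mulnSr; lia.
Qed.

Lemma count_levels_lower (a : pred nat) c b n :
  (forall k j, j < k -> k <= n ->
    2 ^ k <= c * count (fun i => a (M k + j * 2 ^ k + i)) (iota 0 (2 ^ k)) + b) ->
  forall j, j <= n ->
  M n + j * 2 ^ n <= c * count a (iota 0 (M n + j * 2 ^ n)) + b * (n * n + j).
Proof.
elim: n => [|n IHn] hp.
  by move=> j; rewrite leqn0 => /eqP ->.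
have base : M n.+1 <= c * count a (iota 0 (M n.+1)) + b * (n.+1 * n.+1).
  rewrite level_startS; apply: leq_trans (IHn _ n (leqnn n)) _.
    by move=> k j lt_j le_k; apply: hp => //; apply: leqW.
  by rewrite leq_add2l leq_mul2l; apply/orP; right; nia.
elim=> [|j IHj] le_j; first by rewrite !addn0.
rewrite mulSnr addnA count_add mulnDr; have := IHj (ltnW le_j).
have := hp n.+1 j le_j (leqnn _); rewrite !mulnDr mulnSr; lia.
Qed.

Lemma occ_bounds w m :
  let c := count (fun p => win S (size w) p == w) (iota 0 m) in
  occ w (pref S m) <= c + 1 /\ c <= occ w (pref S m) + size w.
Proof.
rewrite occ_pref; set a := fun p => _; move=> /=.
have /andP [_] := count_iota_mono a (leqnSn m); rewrite subSn // subnn => h1.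
have /andP [h2 h3] := count_iota_mono a (leq_subr (size w) m.+1).
have /andP [h4 _] := count_iota_mono a (leqnSn m).
split; first exact: leq_trans h2 h1.
apply: leq_trans h4 (leq_trans h3 _); by rewrite leq_add2l leq_subLR addnC -leq_subLR.
Qed.

(** In [E], the term 2^n pays for the incomplete pass, and l + 1 for each complete pass and once
    more for the end of the prefix. *)
Lemma occ_frequency w n m (l := size w) : M n <= m < M n.+1 ->
  let E := 2 ^ l * (2 ^ n + l.+1 * (n * n + n + 1)) in
  2 ^ l * occ w (pref S m) <= m + E /\ m <= 2 ^ l * occ w (pref S m) + E.
Proof.
move=> /andP [le_m lt_m] E.
have [] := occ_bounds w m; rewrite -/l; set c := count _ _ => o1 o2.
(* [P] is the end of the last complete pass before [m]. *)
pose j := (m - M n) %/ 2 ^ n; pose P := M n + j * 2 ^ n.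
have ej : m = P + (m - M n) %% 2 ^ n.
  by rewrite /P -addnA -divn_eq subnKC.
have lt_r : (m - M n) %% 2 ^ n < 2 ^ n by rewrite ltn_mod.
have lt_j : j <= n.
  by apply: ltnW; rewrite /j ltn_divLR // ltn_subLR // -level_startS.
have hu := @count_levels_upper (fun p => win S l p == w) (2 ^ l) 1 (2 ^ l * l.+1) n _ j lt_j.
have hl := @count_levels_lower (fun p => win S l p == w) (2 ^ l) (2 ^ l * l.+1) n _ j lt_j.
move: hu hl; rewrite -/P; set cP := count _ _ => hu hl.
have {}hu : 2 ^ l * cP <= 1 * P + 2 ^ l * l.+1 * (n * n + j).
  apply: hu => k i lt_i le_k; rewrite mul1n.
  apply: leq_trans (leq_mul (leqnn _) (count_pass_upper w lt_i)) _.
  rewrite -/l mulnDr mulnS addnA leq_add2r; case: (leqP l k) => le_l.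
    by rewrite -expnD subnKC // leq_addr.
  by rewrite (eqP (ltnW le_l : k - l == 0)) muln1 leq_addl.
have {}hl : P <= 2 ^ l * cP + 2 ^ l * l.+1 * (n * n + j).
  apply: hl => k i lt_i le_k; case: (leqP l k) => le_l.
    rewrite -{1}(subnKC le_l) expnD.
    apply: leq_trans (leq_mul (leqnn _) (count_pass_lower lt_i le_l)) _.
    by rewrite -/l mulnDr leq_add2l leq_mul2l leqnSn orbT.
  apply: leq_trans (leq_addl _ _); rewrite -[2 ^ k]muln1.
  by apply: leq_mul => //; rewrite leq_exp2l // ltnW.
have le_P : P <= m by rewrite ej leq_addr.
have /andP [c1 c2] := count_iota_mono (fun p => win S l p == w) le_P.
have {}c2 : c <= cP + 2 ^ n by apply: leq_trans c2 _; rewrite leq_add2l; lia.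
rewrite -/c -/cP in c1 c2.
have e2 := exp2_gt0 l; move: (2 ^ l) e2 @E hu hl => b b0 /=.
move: lt_r; set r := _ %% _ => lt_r.
have {}ej : m = P + r by [].
move: (occ w _) o1 o2 => o o1 o2 hu hl.
have h1 : b * l.+1 * (n * n + j) <= b * (l.+1 * (n * n + n)).
  by rewrite -mulnA !leq_mul2l; lia.
have h2 : b * o <= b * (cP + 2 ^ n + 1) by rewrite leq_mul2l; lia.
have h3 : b * cP <= b * (o + l) by rewrite leq_mul2l; lia.
have h4 : 2 ^ n <= b * 2 ^ n by rewrite leq_pmull.
rewrite !mulnDr !muln1 in h1 h2 h3 *.
have h5 : b * l.+1 = b * l + b by rewrite mulnSr.
by rewrite h5 in h1 h2 h3 *; split; lia.
Qed.

(** * PPM* on the sequence *)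

(** Padded with zeros to length n - 1, the word is a block of the finished level n - 1. *)
Lemma short_word_occurs w n q : 0 < size w -> size w < n -> M n <= q ->
  0 < occ w (pref S q).
Proof.
case: n => [|n] // w0; rewrite ltnS => le_w le_q.
have n0 : 0 < n by apply: leq_trans le_w.
have sw : size (w ++ nseq (n - size w) false) = n by rewrite size_cat size_nseq subnKC.
have [i lt_i ei] := block_surj n0 sw.
apply/occ_gt0P; exists (M n + n * i).
  apply: leq_trans le_q; rewrite level_startS -addnA leq_add2l.
  apply: leq_trans (leq_add (leqnn _) le_w) _.
  by rewrite -mulnSr leq_mul2l lt_i orbT.
by rewrite -(take_win S _ le_w) ei take_size_cat.
Qed.

Lemma occ_upper w n q : 0 < n -> n - 3 <= size w -> q <= M n.+1 ->
  occ w (pref S q) <= (n + 8) * (n * n + n).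
Proof.
move=> n0 le_w le_q; set l := n - 3 in le_w.
rewrite -(cat_take_drop l w); apply: leq_trans (occ_catr _ _ _ _) _.
move: (take l w) (size_takel le_w) => v sv; rewrite occ_pref sv.
have le_m : q.+1 - l <= (M n + n * 2 ^ n).+1 by rewrite -level_startS; lia.
have /andP [h _] := count_iota_mono (fun p => win S l p == v) le_m.
(* A word of length n - 3 occurs at most 2^3 + (n - 3) times per pass of a level up to [n]; [n + 7]
   also covers the truncated cases n < 3. *)
have := @count_levels_upper (fun p => win S l p == v) 1 0 (n + 7) n _ n (leqnn n).
rewrite !mul1n mul0n add0n => hu; apply: leq_trans h _.
rewrite -addn1 count_add /=; set c := nat_of_bool _.
have : c + 0 <= 1 by rewrite /c; case: (_ == _).
suff hc : count (fun p => win S l p == v) (iota 0 (M n + n * 2 ^ n)) <=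
    (n + 7) * (n * n + n) by nia.
apply: hu => k j lt_j le_k; rewrite mul1n mul0n add0n -{1}sv.
apply: leq_trans (count_pass_upper v lt_j) _; rewrite sv.
have : 2 ^ (k - l) <= 2 ^ 3 by rewrite leq_exp2l //; lia.
rewrite /l; change (2 ^ 3) with 8; lia.
Qed.

Definition ctx_bound n := 2 * ((n + 8) * (n * n + n)).

Lemma ppm_prob_lower n q b : 0 < n -> M n <= q <= M n.+1 ->
  (/ (2 * INR (ctx_bound n + 2) ^ 2) <= ppm_prob_bit (pref S q) b)%R.
Proof.
move=> n0 /andP [le_q le_q'].
have short k c : k < n - 2 -> k <= q -> 0 < cnt (ctx_suffix k (pref S q)) c (pref S q).
  move=> lt_k le_k; apply: (@short_word_occurs _ n); rewrite ?size_rcons //.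
  by rewrite size_ctx //; lia.
have n_q : n - 2 <= q.
  by case: n n0 le_q {le_q' short} => [|n] // _; have := level_start_ge n; lia.
apply: ppm_prob_bit_lower => k /andP [le_ck le_k].
(* A shorter current context is not deterministic, having seen both bits, and not the longest
   relevant one, since length n - 2 is relevant. *)
have cur : n - 2 <= current (pref S q).
  have [r [/andP [le_r _] hr _ dr _]] := current_spec S q b.
  rewrite leqNgt; apply/negP => lt_c.
  have le_c : current (pref S q) <= q by lia.
  case/orP: dr => [|/eqP er].
    by rewrite /deterministic /esc !short.
  have lt1 : n - 3 < n - 2 by lia.
  have t0 : 0 < tot (ctx_suffix (n - 2) (pref S q)) (pref S q).
    rewrite addn_gt0; apply/orP; left.
    by apply: (@short_word_occurs _ n); rewrite ?size_rcons // size_ctx //; lia.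
  have : n - 2 <= r by rewrite -hr //; lia.
  by rewrite -er; lia.
by rewrite /tot /ctx_bound mul2n -addnn leq_add //; apply: occ_upper;
  rewrite // size_rcons size_ctx //; lia.
Qed.

Definition ctx_len n := n + n ^ 2.

(* [clash n t a]: the context of length [ctx_len n] preceding position
   [t + ctx_len n] of the cycle [d n] recurs at [a] but is followed there by
   the other bit. *)
Definition clash n t a :=
  (win S (ctx_len n) a == win (d n) (ctx_len n) t)
  && (S (a + ctx_len n) != d n (t + ctx_len n)).

(* The length-[n] window just before the wrong bit identifies a position of the
   cycle, hence cannot lie inside another clashing context. *)
Lemma clash_separated n t t' a a' :
  t + ctx_len n < 2 ^ n -> t' + ctx_len n < 2 ^ n ->
  clash n t a -> clash n t' a' -> a <= a' < a + n ^ 2 -> t = t'.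
Proof.
rewrite /clash /ctx_len; move: (n ^ 2) => G lt_t lt_t'.
move=> /andP [/eqP e /eqP ne] /andP [/eqP e' /eqP ne'] /andP [].
rewrite leq_eqVlt => /orP [/eqP ea _|lt_a lt_a'].
  have /sub_win : win (d n) (n + G) t = win (d n) (n + G) t' by rewrite -e -e' ea.
  move=> /(_ n 0); rewrite !addn0 => /(_ (leq_addr _ _)).
  by apply: win_d_inj; lia.
have s1 := sub_win (l' := n) (e := G) e (eq_leq (addnC _ _)).
have := sub_win (l' := n) (e := a + G - a') e'.
have -> : a' + (a + G - a') = a + G by lia.
rewrite s1 => /(_ _)/win_d_inj h.
have {}h : t + G = t' + (a + G - a') by apply: h; lia.
(* The wrong bit after the first context lies inside the second, which forces it to be the right
   one. *)
have := win_inj (k := a + G - a' + n) e'.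
have -> : a' + (a + G - a' + n) = a + (n + G) by lia.
have -> : t' + (a + G - a' + n) = t + (n + G) by lia.
by move=> h'; case: ne; apply: h'; lia.
Qed.

Definition clashing n t := has (clash n t) (iota 0 (M n.+1 - ctx_len n)).

Lemma count_le (a : pred nat) N s :
  (forall p, p < N -> a p -> p \in s) -> count a (iota 0 N) <= size s.
Proof.
move=> hs; rewrite -size_filter; apply: uniq_leq_size.
  by rewrite filter_uniq ?iota_uniq.
by move=> p; rewrite mem_filter mem_iota => /andP [ap /= lt_p]; apply: hs.
Qed.

(** Send each clashing [t] to the interval of length n^2 containing its first clash; by
    [clash_separated] this is injective. *)
Lemma count_clashing n : 0 < n ->
  count (clashing n) (iota 0 (2 ^ n - ctx_len n)) <= (M n.+1 %/ n ^ 2).+1.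
Proof.
move=> n0; have G0 : 0 < n ^ 2 by rewrite expn_gt0 n0.
pose m := M n.+1 - ctx_len n; pose s := filter (clashing n) (iota 0 (2 ^ n - ctx_len n)).
pose pos t := find (clash n t) (iota 0 m).
have posP t : t \in s -> [/\ t + ctx_len n < 2 ^ n, pos t < m & clash n t (pos t)].
  rewrite mem_filter mem_iota /= add0n => /andP [ct lt_t].
  have lt_p : pos t < m by move: ct; rewrite /clashing has_find size_iota.
  by split=> //; [lia|have := nth_find 0 ct; rewrite nth_iota].
rewrite -size_filter -/s -(size_map (fun t => pos t %/ n ^ 2)).
rewrite -[X in _ <= X](size_iota 0); apply: uniq_leq_size.
  rewrite map_inj_in_uniq; first by rewrite filter_uniq ?iota_uniq.
  move=> t t' /posP [lt_t _ ct] /posP [lt_t' _ ct'] e.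
  have near a a' : a %/ n ^ 2 = a' %/ n ^ 2 -> a' < a + n ^ 2.
    move=> ea; rewrite (divn_eq a' (n ^ 2)) (divn_eq a (n ^ 2)) ea.
    by have := ltn_pmod a' G0; lia.
  case: (leqP (pos t) (pos t')) => [le_p|/ltnW le_p].
    by apply: clash_separated ct ct' _ => //; rewrite le_p near.
  by apply/esym; apply: clash_separated ct' ct _ => //; rewrite le_p near.
move=> _ /mapP [t /posP [_ lt_p _] ->]; rewrite mem_iota /= add0n ltnS.
by apply: leq_div2r; move: lt_p; rewrite /m; lia.
Qed.

(** Outside the first clause the context lies inside the pass, with [n] bits to spare for the
    different shifts of earlier passes; outside the second the shifted position stays within one
    period. *)
Definition bad n j i := [|| i < ctx_len n + n, 2 ^ n <= i + n
  | clashing n (shift n j + i - ctx_len n)].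

Definition bad_bound n := ctx_len n + n + n + (M n.+1 %/ n ^ 2).+1.

Lemma count_bad n j : j < n -> count (bad n j) (iota 0 (2 ^ n)) <= bad_bound n.
Proof.
move=> lt_j; have n0 : 0 < n by apply: leq_ltn_trans lt_j.
have sh := shift_lt lt_j.
pose s := [seq t + ctx_len n - shift n j | t <- filter (clashing n) (iota 0 (2 ^ n - ctx_len n))].
have ss : size s <= (M n.+1 %/ n ^ 2).+1 by rewrite size_map size_filter count_clashing.
pose u := iota 0 (ctx_len n + n) ++ iota (2 ^ n - n) n ++ s.
apply: (@leq_trans (size u)); last by rewrite /u !size_cat !size_iota addnA leq_add2l.
apply: count_le => i lt_i; rewrite /bad /u !mem_cat !mem_iota add0n.
case: ltnP => //= le_i.
case: (leqP (2 ^ n) (i + n)) => /= [h _|h ci]; apply/orP; first by left; lia.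
right; apply/mapP; exists (shift n j + i - ctx_len n); last by lia.
by rewrite mem_filter ci mem_iota; lia.
Qed.

(** The context has been followed by the right bit in each of the [j] earlier passes, and never by
    the wrong one, as that would be a clash. *)
Lemma ppm_prob_repeat n j i : 0 < j < n -> i < 2 ^ n -> ~~ bad n j i ->
  let q := M n + j * 2 ^ n + i in
  (INR j / INR j.+1 <= ppm_prob_bit (pref S q) (S q))%R.
Proof.
move=> /andP [j0 lt_j] lt_i; rewrite /bad !negb_or -leqNgt -ltnNge.
move=> /and3P [le_i lt_in ncl]; set q := M n + j * 2 ^ n + i.
set K := ctx_len n in le_i ncl *; set t := shift n j + i - K in ncl.
have sh := shift_lt lt_j.
have le_K : K <= q by rewrite /q; lia.
have cE : ctx_suffix K (pref S q) = win (d n) K t.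
  rewrite ctxE //; have -> : q - K = M n + j * 2 ^ n + (i - K) by rewrite /q; lia.
  by rewrite win_pass //; [congr win; rewrite /t; lia | lia].
have SqE : S q = d n (t + K) by rewrite /q S_pass //; congr d; rewrite /t; lia.
have lt_q : q < M n.+1.
  rewrite /q level_startS -addnA ltn_add2l.
  apply: (@leq_trans (j.+1 * 2 ^ n)); last by rewrite leq_mul2r lt_j orbT.
  by rewrite mulSnr ltn_add2l.
apply: (@ppm_prob_bit_repeat _ _ _ K) => //.
  rewrite /cnt cE occ_pref size_rcons size_win.
  (* The places where the earlier passes read cycle position [t]. *)
  pose s := [seq M n + j' * 2 ^ n + (t - shift n j') | j' <- iota 0 j].
  have -> : j = size s by rewrite size_map size_iota.
  have lt_t : t + K < 2 ^ n by rewrite /t; lia.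
  have le_t : n <= t by rewrite /t; lia.
  apply: count_ge.
    rewrite map_inj_in_uniq ?iota_uniq // => a b _ _; rewrite -!addnA => /addnI e.
    have : (a * 2 ^ n + (t - shift n a)) %/ 2 ^ n =
      (b * 2 ^ n + (t - shift n b)) %/ 2 ^ n by rewrite e.
    by rewrite !divnMDl // !divn_small ?addn0; lia.
  move=> _ /mapP [j' + ->]; rewrite mem_iota /= add0n => lt_j'.
  have lt_jn := ltn_trans lt_j' lt_j; have sh' := shift_lt lt_jn.
  split.
    have : j'.+1 * 2 ^ n <= j * 2 ^ n by rewrite leq_mul2r lt_j' orbT.
    by rewrite mulSnr /q; lia.
  rewrite win_pass //; last by lia.
  by rewrite subnKC ?win_rcons ?SqE //; lia.
apply/eqP; rewrite -leqn0 leqNgt; apply/negP => /occ_gt0P [p].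
rewrite size_rcons size_ctx // win_rcons => le_p /eqP.
rewrite eqseq_rcons cE => /andP [/eqP ep /eqP eb].
case/negP: ncl; apply/hasP; exists p; first by rewrite mem_iota; lia.
by rewrite /clash -/K ep eqxx eb SqE; case: (d n _).
Qed.

End Sequence.

(** * Rates *)

Lemma INR_expn k n : INR (k ^ n) = (INR k ^ n)%R.
Proof. by elim: n => [|n IHn] //; rewrite expnS mult_INR IHn. Qed.

Lemma leq_INR m n : m <= n -> (INR m <= INR n)%R.
Proof. by move=> h; apply: le_INR; apply/leP. Qed.

Lemma INR4 : INR 4 = 4%R.
Proof. by rewrite /=; lra. Qed.

Lemma INR_ge1 n : 0 < n -> (1 <= INR n)%R.
Proof. exact: (@leq_INR 1). Qed.

Lemma cube_le_exp n : n ^ 3 <= 4 * 2 ^ n.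
Proof.
(* Equality holds at 4, and from there on a step at most doubles the cube. *)
suff H k : (k + 4) ^ 3 <= 4 * 2 ^ (k + 4).
  case: n => [|[|[|[|n]]]] //.
  by have := H n; rewrite addnC.
elim: k => [|k IHk] //; rewrite addSn [2 ^ _]expnS mulnCA.
apply: leq_trans (leq_mul (leqnn 2) IHk).
by rewrite !expnS !expn0; nia.
Qed.

Definition rsum (f : nat -> R) (s : seq nat) : R := foldr (fun i acc => f i + acc)%R 0%R s.

Lemma rsum_cat f s t : rsum f (s ++ t) = (rsum f s + rsum f t)%R.
Proof. by elim: s => [|i s IHs] /=; [rewrite Rplus_0_l | rewrite IHs Rplus_assoc]. Qed.

Lemma rsum_iota_add f p N :
  rsum f (iota 0 (p + N)) = (rsum f (iota 0 p) + rsum (fun i => f (p + i)%N) (iota 0 N))%R.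
Proof.
rewrite iotaD rsum_cat add0n; congr (_ + _)%R.
by rewrite -[p in iota p N]addn0 iotaDl; elim: (iota 0 N) => //= i s ->.
Qed.

Lemma rsum_ge0 f s : (forall i, 0 <= f i)%R -> (0 <= rsum f s)%R.
Proof. by move=> f0; elim: s => [|i s IHs] /=; [lra | have := f0 i; lra]. Qed.

Lemma rsum_mono f p q : (forall i, 0 <= f i)%R -> p <= q ->
  (rsum f (iota 0 p) <= rsum f (iota 0 q))%R.
Proof.
move=> f0 /subnKC <-; rewrite rsum_iota_add.
by have := rsum_ge0 (iota 0 (q - p)) (fun i => f0 (p + i)); lra.
Qed.

Lemma rsum_split_le f (b : pred nat) beta gamma s : (0 <= beta)%R -> (0 <= gamma)%R ->
  (forall i, i \in s -> (f i <= if b i then beta else gamma)%R) ->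
  (rsum f s <= INR (size s) * gamma + INR (count b s) * beta)%R.
Proof.
move=> b0 g0; elim: s => [|i s IHs] hf; first by rewrite /=; lra.
have := hf i (mem_head _ _).
have /IHs {IHs} : forall i, i \in s -> (f i <= if b i then beta else gamma)%R.
  by move=> k hk; apply: hf; rewrite inE hk orbT.
rewrite -[size (i :: s)]/(size s).+1 -[count b (i :: s)]/(b i + count b s).
rewrite -[rsum f (i :: s)]/(f i + rsum f s)%R S_INR plus_INR.
by case: (b i) => /=; lra.
Qed.

Lemma ln_le_sqrt y : (0 < y)%R -> (ln y <= 2 * sqrt y)%R.
Proof.
move=> y0; have s0 := sqrt_lt_R0 _ y0.
have {1}-> : y = (sqrt y * sqrt y)%R by rewrite sqrt_sqrt //; lra.
rewrite ln_mult //; have := exp_ineq1_le (ln (sqrt y)); rewrite exp_ln //; lra.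
Qed.

(** Turns error terms of order 2^n into terms of order m / n. *)
Lemma level_start_quarter n m : 1 < n -> level_start n <= m ->
  (INR n * INR (2 ^ n) <= 4 * INR m)%R.
Proof.
move=> n1 le_m; rewrite -mult_INR -INR4 -mult_INR; apply: leq_INR.
apply: leq_trans (leq_mul (leqnn 4) le_m).
case: n n1 {le_m} => [|n] // n1.
apply: leq_trans (leq_mul (leqnn 4) (level_start_lower n)).
by rewrite expnS; have := expn_gt0 2 n; nia.
Qed.

Lemma is_lim_seq_levels (u : nat -> R) (l : R) :
  (forall eps : R, (0 < eps)%R -> exists n0, forall n m,
    n0 <= n -> level_start n <= m < level_start n.+1 -> (Rabs (u m - l) < eps)%R) ->
  is_lim_seq u l.
Proof.
move=> h; apply/is_lim_seq_spec => eps; have [n0 hn] := h eps (cond_pos eps).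
exists (level_start n0) => m /leP le_m; have [n /[dup] hm /andP [_ lt_m]] := level_ex m.
by apply: (hn n) => //; rewrite -ltnS; apply: level_start_inv lt_m le_m.
Qed.

Section Rates.
Variables (d : nat -> binseq) (S : binseq).
Hypothesis dB : forall n, is_de_bruijn n (d n).
Hypothesis SE : level_seq S d.
Local Notation M := level_start.

Let exp2_gt0 n : 0 < 2 ^ n. Proof. exact: expn_gt0. Qed.

Lemma normal_level_seq : normal S.
Proof.
move=> w; apply: is_lim_seq_levels => eps eps0.
(* The 4 is that of [level_start_quarter]; the 12 comes from n^2 + n + 1 <= 12 * 2^n. *)
pose C := INR (4 * (1 + 12 * (size w).+1)).
have [n0 hn0] := INR_unbounded (C / eps); exists (maxn n0 2) => n m.
rewrite geq_max => /andP [le_n n1] hm; have [h1 h2] := occ_frequency dB SE w hm.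
have /andP [le_m _] := hm; have hq := level_start_quarter n1 le_m.
move: (occ w _) h1 h2 => o; set E := _ * (2 ^ n + _) => h1 h2.
have n_pos : (1 <= INR n)%R by apply: INR_ge1; apply: ltnW.
have p_pos : (1 <= INR (2 ^ n))%R by apply: INR_ge1.
have m_pos : (0 < INR m)%R by nra.
have e2 : INR (2 ^ size w) = (2 ^ size w)%R by rewrite INR_expn.
have l_pos : (1 <= 2 ^ size w)%R by rewrite -e2; apply: INR_ge1.
have hE : 4 * E <= 2 ^ size w * (4 * (1 + 12 * (size w).+1) * 2 ^ n).
  rewrite /E mulnCA leq_mul2l; apply/orP; right.
  have : n * n + n + 1 <= 12 * 2 ^ n by have := cube_le_exp n; rewrite !expnS expn0; nia.
  by move: (size w).+1 (2 ^ n) => l P; nia.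
clearbody E; move/leq_INR: hE.
rewrite (mult_INR 4 E) INR4 (mult_INR (2 ^ size w)) (mult_INR _ (2 ^ n)) -/C e2 => hE.
have hC : (C < eps * INR n)%R.
  apply: Rlt_le_trans (Rmult_le_compat_l _ _ _ (Rlt_le _ _ eps0) (leq_INR le_n)).
  by rewrite Rmult_comm; apply/Rlt_div_l.
move/leq_INR: h1; move/leq_INR: h2; rewrite !plus_INR !mult_INR e2 => h2 h1.
have hEm : (INR E < 2 ^ size w * (eps * INR m))%R.
  have h3 : (C * INR (2 ^ n) < eps * INR n * INR (2 ^ n))%R.
    by apply: Rmult_lt_compat_r hC; lra.
  have h4 : (eps * (INR n * INR (2 ^ n)) <= eps * (4 * INR m))%R.
    by apply: Rmult_le_compat_l hq; lra.
  have h5 : (2 ^ size w * (C * INR (2 ^ n)) < 2 ^ size w * (4 * (eps * INR m)))%R.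
    by apply: Rmult_lt_compat_l; lra.
  lra.
have -> : (INR o / INR m - / 2 ^ size w = (2 ^ size w * INR o - INR m) / (2 ^ size w * INR m))%R.
  by field; lra.
rewrite Rabs_div; last by nra.
rewrite [X in (_ / X)%R]Rabs_pos_eq; last by nra.
apply/Rlt_div_l; first by nra.
by apply: Rabs_def1; nra.
Qed.

(** Truncation at 0 makes [total_cost] monotone without a proof that probabilities are at most 1.
    Costs use natural logarithms. *)
Definition cost q : R := Rmax 0 (- ln (ppm_prob_bit (pref S q) (S q))).
Definition total_cost m : R := rsum cost (iota 0 m).

Lemma cost_ge0 q : (0 <= cost q)%R.
Proof. exact: Rmax_l. Qed.

Lemma cost_le q p : (0 < p)%R -> (p <= 1)%R ->
  (p <= ppm_prob_bit (pref S q) (S q))%R -> (cost q <= - ln p)%R.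
Proof.
move=> p0 p1 hp; apply: Rmax_lub.
  by have := ln_le _ _ p0 p1; rewrite ln_1; lra.
by have := ln_le _ _ p0 hp; lra.
Qed.

(** The logarithm of (4n)^6, a bound for the cost of any single bit of level [n]. *)
Definition beta n : R := (6 * ln (INR (4 * n)))%R.

Lemma ln_le_beta n : 0 < n -> (0 <= ln (INR n) <= beta n)%R.
Proof.
move=> n0; have h1 := INR_ge1 n0.
have h : (0 <= ln (INR n))%R by rewrite -ln_1; apply: ln_le; lra.
split=> //; rewrite /beta; have : (ln (INR n) <= ln (INR (4 * n)))%R; last lra.
by apply: ln_le; [lra | apply: leq_INR; rewrite leq_pmull].
Qed.

Lemma cost_le_beta n q : 0 < n -> M n <= q <= M n.+1 -> (cost q <= beta n)%R.
Proof.
move=> n0 hq; have hp := ppm_prob_lower dB SE (S q) n0 hq.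
set N := (2 * INR (ctx_bound n + 2) ^ 2)%R in hp.
have N1 : (1 <= N)%R.
  have : (1 <= INR (ctx_bound n + 2))%R by apply: INR_ge1; rewrite addn2.
  by rewrite /N; nra.
have i0 : (0 < / N)%R by apply: Rinv_0_lt_compat; lra.
apply: Rle_trans (cost_le i0 _ hp) _.
  by rewrite -Rinv_1; apply: Rinv_le_contravar; lra.
rewrite ln_Rinv ?Ropp_involutive; last by lra.
have n4 : (0 < INR (4 * n))%R by apply: lt_0_INR; apply/ltP; lia.
have -> : beta n = ln (INR (4 * n) ^ 6) by rewrite ln_pow // /beta /=; congr (_ * _)%R; ring.
apply: ln_le; first by lra.
rewrite /N -[2%R]/(INR 2) -!INR_expn -mult_INR multE; apply: leq_INR.
(* With n >= 1, 38 = 2 * 9 * 2 + 2; then 2 * 38^2 = 2888 is below 4^6 = 4096. *)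
rewrite /ctx_bound; have h : 2 * ((n + 8) * (n * n + n)) + 2 <= 38 * n ^ 3.
  by rewrite !expnS expn0; nia.
apply: (@leq_trans (2 * (38 * n ^ 3) ^ 2)); first by rewrite leq_mul2l leq_exp2r.
rewrite (expnMn 38) (expnMn 4) -expnM mulnA leq_mul2r; apply/orP; right.
by [].
Qed.

Lemma pass_cost n j : 0 < j < n ->
  (rsum (fun i => cost (M n + j * 2 ^ n + i)) (iota 0 (2 ^ n)) <=
   INR (2 ^ n) * (ln (INR j.+1) - ln (INR j)) + INR (bad_bound n) * beta n)%R.
Proof.
move=> hj; have /andP [j0 lt_j] := hj; have n0 : 0 < n := ltn_trans j0 lt_j.
have [l0 lb] := ln_le_beta n0; have b0 : (0 <= beta n)%R by lra.
have j1 := INR_ge1 j0.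
have g0 : (0 <= ln (INR j.+1) - ln (INR j))%R.
  have : (ln (INR j) <= ln (INR j.+1))%R by apply: ln_le; rewrite ?S_INR; lra.
  lra.
have hc i : i \in iota 0 (2 ^ n) -> (cost (M n + j * 2 ^ n + i) <=
    if bad d S n j i then beta n else ln (INR j.+1) - ln (INR j))%R.
  rewrite mem_iota /= add0n => lt_i; case: ifP => [_|/negbT nb].
    apply: cost_le_beta => //; rewrite -addnA leq_addr level_startS leq_add2l /=.
    apply: (@leq_trans (j.+1 * 2 ^ n)); last by rewrite leq_mul2r lt_j orbT.
    by rewrite mulSnr leq_add2l ltnW.
  have hp := ppm_prob_repeat dB SE hj lt_i nb.
  have -> : (ln (INR j.+1) - ln (INR j) = - ln (INR j / INR j.+1))%R.
    by rewrite ln_div ?S_INR; lra.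
  apply: cost_le hp; rewrite S_INR.
    by apply: Rdiv_lt_0_compat; lra.
  by apply/Rle_div_l; lra.
apply: Rle_trans (rsum_split_le b0 g0 hc) _; rewrite size_iota.
apply: Rplus_le_compat_l; apply: Rmult_le_compat_r => //.
exact/leq_INR/count_bad.
Qed.

(** The first pass is charged [beta n] per bit; over the later ones ln(j + 1) - ln j telescopes. *)
Lemma passes_cost n J : 0 < n -> J < n ->
  (total_cost (M n + J.+1 * 2 ^ n) <= total_cost (M n) +
    INR (2 ^ n) * (beta n + ln (INR J.+1)) + INR J * (INR (bad_bound n) * beta n))%R.
Proof.
move=> n0; elim: J => [|J IHJ] lt_J.
  rewrite mul1n /total_cost rsum_iota_add [INR 0]/= ln_1.
  have b0 : (0 <= beta n)%R by have := ln_le_beta n0; lra.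
  have hc i : i \in iota 0 (2 ^ n) -> (cost (M n + i) <= if pred0 i then beta n else beta n)%R.
    rewrite mem_iota /= add0n => lt_i; apply: cost_le_beta => //.
    rewrite leq_addr level_startS leq_add2l /=; apply: leq_trans (ltnW lt_i) _.
    by rewrite leq_pmull.
  have := @rsum_split_le (fun i : nat => cost (M n + i)) pred0 _ _ _ b0 b0 hc.
  by rewrite count_pred0 size_iota [INR 0]/=; lra.
rewrite mulSnr addnA /total_cost rsum_iota_add -!/(total_cost _).
have := pass_cost (n := n) (j := J.+1); rewrite lt_J => /(_ isT).
have : (INR J.+1 * (INR (bad_bound n) * beta n) =
  INR J * (INR (bad_bound n) * beta n) + INR (bad_bound n) * beta n)%R by rewrite S_INR; ring.
by have := IHJ (ltnW lt_J); lra.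
Qed.

(** The polynomial part is at most 5 n^3 <= 20 * 2^n, and the clashes contribute 2 * 2^n, because
    level [n] ends by n * 2^(n+1). *)
Lemma bad_bound_le n : 0 < n -> n * bad_bound n <= 22 * 2 ^ n.
Proof.
move=> n0; rewrite /bad_bound /ctx_len.
have h1 : n * (M n.+1 %/ n ^ 2) <= 2 * 2 ^ n.
  rewrite -(leq_pmul2l n0) -expnS; apply: leq_trans (level_start_upper n).
  by rewrite mulnA -[n * n]/(n ^ 2) mulnC leq_divM.
have := cube_le_exp n; have : n <= 2 ^ n by apply/ltnW/ltn_expl.
move: h1; rewrite !expnS !expn0; move: (_ %/ _) => D; nia.
Qed.

(** 24 = 1 + 1 + 22: the first pass, the telescoped logarithm, and the bad positions. *)
Lemma level_cost n : 0 < n ->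
  (total_cost (M n.+1) <= total_cost (M n) + 24 * (INR (2 ^ n) * beta n))%R.
Proof.
case: n => [|n] // n0; have := passes_cost n0 (ltnSn n); rewrite -level_startS.
have [l0 lb] := ln_le_beta n0; have b0 : (0 <= beta n.+1)%R by lra.
have p0 : (0 <= INR (2 ^ n.+1))%R by apply: pos_INR.
have : (INR n * INR (bad_bound n.+1) <= 22 * INR (2 ^ n.+1))%R.
  have -> : 22%R = INR 22 by rewrite /=; lra.
  rewrite -!mult_INR; apply: leq_INR; apply: leq_trans (bad_bound_le n0).
  by rewrite leq_mul2r leqnSn orbT.
move=> /(Rmult_le_compat_r _ _ _ b0).
have := Rmult_le_compat_l _ _ _ p0 lb; lra.
Qed.

Lemma beta_mono n : 0 < n -> (beta n <= beta n.+1)%R.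
Proof.
move=> n0; apply: Rmult_le_compat_l; first lra.
apply: ln_le; first by apply: lt_0_INR; apply/ltP; lia.
by apply: leq_INR; lia.
Qed.

(** The level costs grow at least geometrically with ratio 2, so their sum is within twice the last
    bound. *)
Lemma total_cost_level n : 0 < n -> (total_cost (M n.+1) <= 48 * (INR (2 ^ n) * beta n))%R.
Proof.
elim: n => [|n IHn] // _; have := level_cost (ltn0Sn n).
case: (posnP n) => [->|n0].
  have [l0 lb] := ln_le_beta (ltn0Sn 0).
  have : (0 <= INR (2 ^ 1) * beta 1)%R by apply: Rmult_le_pos; [apply: pos_INR | lra].
  by rewrite (_ : total_cost (M 1) = 0%R) //; lra.
have := IHn n0; rewrite expnS mult_INR [INR 2]/=.
have := Rmult_le_compat_l _ _ _ (pos_INR (2 ^ n)) (beta_mono n0); lra.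
Qed.

(** 4608 = 48 * 24 * 4, where beta n <= 6 * 2 * sqrt(4n) = 24 sqrt n and the 4 is that of
    [level_start_quarter]. *)
Lemma total_cost_bound n m : 1 < n -> M n <= m <= M n.+1 ->
  (total_cost m * sqrt (INR n) <= 4608 * INR m)%R.
Proof.
move=> n1 /andP [le_m lt_m]; have n0 := ltnW n1.
have h1 : (total_cost m <= 48 * (INR (2 ^ n) * beta n))%R.
  by apply: Rle_trans (total_cost_level n0); apply: rsum_mono => //; apply: cost_ge0.
have hn := INR_ge1 n0; have s0 := sqrt_pos (INR n).
have ss := sqrt_sqrt (INR n) (Rlt_le _ _ (Rlt_le_trans _ _ _ Rlt_0_1 hn)).
have hb : (beta n <= 24 * sqrt (INR n))%R.
  rewrite /beta mult_INR INR4; have := ln_le_sqrt (y := (4 * INR n)%R).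
  rewrite sqrt_mult; try lra.
  have -> : sqrt 4 = 2%R by rewrite -(sqrt_square 2); [congr sqrt; lra | lra].
  by move=> h; have := h ltac:(lra); lra.
have hq := level_start_quarter n1 le_m.
have hb2 : (48 * (INR (2 ^ n) * beta n) <= 1152 * (INR (2 ^ n) * sqrt (INR n)))%R.
  by have := Rmult_le_compat_l _ _ _ (pos_INR (2 ^ n)) hb; lra.
have := Rmult_le_compat_r _ _ _ s0 (Rle_trans _ _ _ h1 hb2).
have -> : (1152 * (INR (2 ^ n) * sqrt (INR n)) * sqrt (INR n) =
  1152 * (INR n * INR (2 ^ n)))%R by rewrite -{3}ss; ring.
lra.
Qed.

Lemma ppm_prob_cost m : (0 < ppm_prob (pref S m))%R /\
  (- ln (ppm_prob (pref S m)) <= total_cost m)%R.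
Proof.
rewrite /ppm_prob size_mkseq /total_cost.
have : forall i, i \in iota 0 m -> i < m by move=> i; rewrite mem_iota.
elim: (iota 0 m) => [|i s IHs] hs /=; first by rewrite ln_1; lra.
have [p0 hp] : _ /\ _ := IHs (fun k hk => hs k (mem_behead (s := i :: s) hk)).
have lt_i := hs i (mem_head _ _).
have -> : take i (pref S m) = pref S i by rewrite pref_win take_win // ltnW.
have -> : nth false (pref S m) i = S i by rewrite nth_mkseq.
set p := ppm_prob_bit _ _.
have pp : (0 < p)%R.
  have [n /andP [le_n lt_n]] := level_ex i.
  have n0 : 0 < n by case: n le_n lt_n.
  apply: Rlt_le_trans (ppm_prob_lower dB SE (S i) n0 _); last by rewrite le_n ltnW.
  apply: Rinv_0_lt_compat; have : (0 < INR (ctx_bound n + 2))%R by apply: lt_0_INR; apply/ltP; lia.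
  by nra.
split; first exact: Rmult_lt_0_compat.
rewrite ln_mult // Ropp_plus_distr; apply: Rplus_le_compat hp.
exact: Rmax_r.
Qed.

Lemma ppm_upper_rate L : ppm_code_length L -> upper_rate L S = Rbar.Finite R0.
Proof.
move=> [C hC]; apply: is_LimSup_seq_unique; apply: is_lim_LimSup_seq.
apply: is_lim_seq_levels => eps eps0.
have C0 : (0 <= C)%R by apply: Rle_trans (hC [::]); apply: Rabs_pos.
(* 9216 is twice 4608: the change to base 2 costs a factor 1 / ln 2 < 2. *)
pose A := ((C + 9216) / eps)%R.
have [n0 hn0] := INR_unbounded (A * A); exists (maxn n0 2) => n m.
rewrite geq_max => /andP [le_n n1] /andP [le_m lt_m].
have hn := INR_ge1 (ltnW n1).
have A0 : (0 < A)%R by apply: Rdiv_lt_0_compat; lra.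
have hA : (A < sqrt (INR n))%R.
  rewrite -(sqrt_square A); last by lra.
  by apply: sqrt_lt_1; [nra | lra | have := leq_INR le_n; lra].
have s1 : (sqrt (INR n) <= INR n)%R.
  have := sqrt_le_1 1 (INR n) ltac:(lra) ltac:(lra) hn; rewrite sqrt_1.
  by have := sqrt_sqrt (INR n) ltac:(lra); nra.
have n_m : n <= m.
  apply: leq_trans le_m; case: n n1 {le_n lt_m hn hA s1} => [|[|n]] // _.
  by apply: leq_trans (level_start_lower _); have := expn_gt0 2 n; rewrite expnS; nia.
have m1 : (INR n <= INR m)%R := leq_INR n_m.
have m0 : (0 < INR m)%R by lra.
have hU := total_cost_bound n1 (introT andP (conj le_m (ltnW lt_m))).
have [p0 hp] := ppm_prob_cost m.
have := hC (pref S m); rewrite /log2; set P := ppm_prob _ in p0 hp *; move=> hL.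
have hlen : (INR (L (pref S m)) <= C + 2 * total_cost m)%R.
  have := Rle_abs (INR (L (pref S m)) - - (ln P / ln 2)).
  have ln2 := ln_lt_2; have U0 : (0 <= total_cost m)%R by apply: rsum_ge0; apply: cost_ge0.
  have : (- (ln P / ln 2) <= 2 * total_cost m)%R.
    have -> : (- (ln P / ln 2) = - ln P / ln 2)%R by field; lra.
    by apply/Rle_div_l; [lra | nra].
  lra.
rewrite Rminus_0_r /ratio Rabs_pos_eq; last first.
  by apply: Rmult_le_pos; [apply: pos_INR | apply/Rlt_le/Rinv_0_lt_compat].
apply/Rlt_div_l => //; apply: Rle_lt_trans hlen _.
have sp : (0 < sqrt (INR n))%R by lra.
apply: (Rmult_lt_reg_r (sqrt (INR n))) => //.
have hCs : (C * sqrt (INR n) <= C * INR m)%R by apply: Rmult_le_compat_l; lra.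
have : ((C + 9216) * INR m < eps * INR m * sqrt (INR n))%R.
  have -> : (eps * INR m * sqrt (INR n) = sqrt (INR n) * eps * INR m)%R by ring.
  by apply: Rmult_lt_compat_r => //; apply/Rlt_div_l.
lra.
Qed.

(** The upper estimate is needed only for infinitely many prefixes, and ends of levels are chosen;
    the lower one holds for all long prefixes. *)
Lemma lz_lower_rate : lower_rate lz_len S = Rbar.Finite R1.
Proof.
apply: is_LimInf_seq_unique => eps; have eps0 := cond_pos eps; split.
  move=> N; have [t0 ht0] := INR_unbounded (32 / eps).
  have [t [t1 N_t tR]] : exists t, [/\ 0 < t, N <= t & (32 / eps < INR t)%R].
    exists (maxn t0 N).+1; split=> //; first by rewrite leqW // leq_maxr.
    by apply: Rlt_le_trans ht0 (leq_INR _); rewrite leqW ?leq_maxl.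
  (* For a power of two the number of digits of [n] is exactly t + 1. *)
  pose n := 2 ^ t; exists (M n.+1).
  have n_t : t < n by apply: ltn_expl.
  have le_M : n * 2 ^ n <= M n.+1 := level_start_lower n.
  have n_n : n < 2 ^ n by apply: ltn_expl.
  split.
    apply/leP/(leq_trans N_t)/(leq_trans (ltnW n_t))/(leq_trans _ le_M).
    by rewrite leq_pmulr.
  have m0 : 0 < M n.+1 by nia.
  have := lz_len_upper dB SE n; rewrite size_bin ?exp2_gt0 // trunc_expnK //.
  set l := lz_len _ => hl.
  (* 32 = 8 * 4: the overhead is at most 8 t 2^n, and t^3 <= 4n. *)
  have hl2 : t * l <= t * M n.+1 + 32 * M n.+1.
    have := cube_le_exp t; rewrite -/n expnS => ht.
    move: hl le_M; rewrite expnS; move: (2 ^ n) (M n.+1) => P m hl le_M.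
    have h1 : t * (2 * P * (2 * t.+1)) <= 8 * (t ^ 2 * P) by rewrite expnS expn1; nia.
    have h2 : t * (t ^ 2 * P) <= 4 * (n * P) by nia.
    have h3 : t ^ 2 * P <= t * (t ^ 2 * P) by rewrite leq_pmull.
    have : t * l <= t * (m + 2 * P * (2 * t.+1)) by rewrite leq_mul2l hl orbT.
    by rewrite mulnDr; lia.
  have m0R := INR_ge1 m0; rewrite /ratio -/l; apply/Rlt_div_l; first by lra.
  have {}tR : (32 < INR t * eps)%R by apply/Rlt_div_l.
  move/leq_INR: hl2; rewrite plus_INR !(mult_INR t) (mult_INR 32) => hl2.
  have e32 : INR 32 = 32%R by rewrite /=; lra.
  have t1R := INR_ge1 t1.
  apply: (Rmult_lt_reg_l (INR t)); first by lra.
  have := Rmult_lt_compat_r _ _ _ (Rlt_le_trans _ _ _ Rlt_0_1 m0R) tR.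
  rewrite e32 in hl2; lra.
(* The deficit is at most [n], whereas m >= n 2^n / 4 >= n^2 / 4. *)
have [n0 hn0] := INR_unbounded (4 / eps); exists (M (maxn n0 2)) => m /leP le_m.
have [n /andP [le_n lt_n]] := level_ex m.
have : maxn n0 2 <= n by rewrite -ltnS; apply: level_start_inv lt_n le_m.
rewrite geq_max => /andP [n_n0 n1]; have := lz_len_lower dB SE lt_n; set l := lz_len _ => hl.
have hq := level_start_quarter n1 le_n; have hn := INR_ge1 (ltnW n1).
have n2 : (INR n <= INR (2 ^ n))%R by apply: leq_INR; apply/ltnW/ltn_expl.
have m0 : (0 < INR m)%R by nra.
rewrite /ratio -/l; apply/Rlt_div_r => //.
move/leq_INR: hl; rewrite plus_INR => hl.
have hne : (4 < INR n * eps)%R.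
  by apply/Rlt_div_l => //; apply: Rlt_le_trans hn0 (leq_INR n_n0).
have hnm : (eps * (INR n * INR n) <= eps * (4 * INR m))%R by apply: Rmult_le_compat_l; nra.
have := Rmult_lt_compat_r (INR n) _ _ ltac:(lra) hne; lra.
Qed.

End Rates.

Theorem theorem4 :
  exists S : binseq,
    normal S /\
    (forall L : seq bool -> nat, ppm_code_length L -> upper_rate L S = Rbar.Finite R0) /\
    lower_rate lz_len S = Rbar.Finite R1.
Proof.
have [d dB] := functional_choice _ de_bruijn_exists.
have [S SE] := level_seq_exists d.
exists S; split; first exact: normal_level_seq dB SE.
by split; [move=> L; apply: ppm_upper_rate dB SE _ | apply: lz_lower_rate dB SE].
Qed.
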